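(* Let $\psi(t)$ be a wavelet with $N$ vanishing moments. Then the Hartley-Like wavelet $\psi_H(t)=\frac{1}{\sqrt2}\left[\psi(t)\mp\mathcal{H}\{\psi\}(t)\right]$ (for either choice of the sign), where $\mathcal{H}\{\psi\}$ is the Hilbert transform of $\psi$, also has $N$ vanishing moments.
   Context: A function $\psi(t)$ is a (mother) wavelet if and only if (i) $\psi$ is in the space $L^2(\mathbb{R})$ of finite energy functions and (ii) $\psi$ satisfies the admissibility condition $\int_{-\infty}^{\infty}\frac{|\Psi(\omega)|^2}{|\omega|}\,d\omega<+\infty$, where $\Psi(\omega)$ is the Fourier transform of $\psi(t)$, with $\omega$ the angular frequency. The Hilbert transform of a function $g$ is $\mathcal{H}\{g\}(t)=\mathrm{p.v.}\,\frac{1}{\pi}\int_{-\infty}^{\infty}\frac{g(\tau)}{t-\tau}\,d\tau$, where p.v. denotes the Cauchy principal value. The $n$th moment of a function $f$ is $M_n[f(t)]=\int_{-\infty}^{\infty}t^n f(t)\,dt$, and $f$ has $N$ vanishing moments if $M_n[f(t)]=0$ for $n=0,1,\ldots,N-1$.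
   Formalization: The formal statement additionally assumes that the moments of the Hartley-Like wavelet of orders 0 to N−1 exist (as Lebesgue integrals); without this the claim fails, since a wavelet with zero mean can have a non-integrable Hilbert transform. *)

(* Defs.v *)
From mathcomp Require Import all_boot all_order all_algebra.
From mathcomp Require Import complex.
From mathcomp Require Import all_classical all_reals all_analysis.
Import Order.TTheory GRing.Theory Num.Theory.
Import numFieldNormedType.Exports.
Import ComplexField.Normc.

Set Implicit Arguments.
Unset Strict Implicit.
Unset Printing Implicit Defensive.

Local Open Scope classical_set_scope.
Local Open Scope complex_scope.
Local Open Scope ring_scope.

Section HartleyLikeWavelets.
Context {R : realType}.
Implicit Types (D : set R) (f g psi Psi : R -> R[i]).

Local Notation mu := (@lebesgue_measure R).

(* Lebesgue integration of complex-valued functions, componentwise.  [cintegral]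
   is total, so it has to be read together with [cintegrable]. *)
Definition cintegrable D f : Prop :=
  mu.-integrable D (fun t => (complex.Re (f t))%:E) /\
  mu.-integrable D (fun t => (complex.Im (f t))%:E).

Definition cintegral D f : R[i] :=
  (\int[mu]_(t in D) complex.Re (f t)) +i* (\int[mu]_(t in D) complex.Im (f t)).

Definition finite_energy f : Prop :=
  (fun t => complex.Re (f t)) \in Lfun mu 2%:E /\
  (fun t => complex.Im (f t)) \in Lfun mu 2%:E.

(* A function of L^2 need not be integrable, so its Fourier transform is the
   limit in L^2, as A -> +oo, of the integrals over [-A, A]. *)
Definition truncated_fourier f (A : R) (w : R) : R[i] :=
  cintegral `[- A, A] (fun t => (cos (w * t) -i* sin (w * t)) * f t).

Definition is_fourier_transform f Psi : Prop :=
  finite_energy Psi /\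
  ('N[mu]_(2%:E)[(fun w => (normc (Psi w - truncated_fourier f A w))%:E)])%E
    @[A --> +oo%R] --> 0%E.

(* The transform is unique up to a null set, on which the admissibility integral
   does not depend; the junk value [x / 0 = 0] at w = 0 is harmless as well. *)
Definition wavelet psi : Prop :=
  finite_energy psi /\
  exists2 Psi, is_fourier_transform psi Psi &
    (\int[mu]_w (normc (Psi w) ^+ 2 / `|w|)%:E < +oo)%E.

(* For g in L^2 the integrand is integrable at infinity, so the principal value
   only concerns the singularity tau = t. *)
Definition truncated_hilbert g (t eps : R) : R[i] :=
  (pi^-1)%:C * cintegral [set tau | eps < `|t - tau|]
                         (fun tau => g tau / (t - tau)%:C).

(* The limit exists for almost every t when g is in L^2; [lim] is an unspecified
   value at the remaining points. *)
Definition hilbert_transform g (t : R) : R[i] :=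
  lim (complex.Re (truncated_hilbert g t eps) @[eps --> 0^'+]) +i*
  lim (complex.Im (truncated_hilbert g t eps) @[eps --> 0^'+]).

Definition has_moment (n : nat) f : Prop :=
  cintegrable setT (fun t => (t ^+ n)%:C * f t).

Definition moment (n : nat) f : R[i] :=
  cintegral setT (fun t => (t ^+ n)%:C * f t).

Definition vanishing_moments (N : nat) f : Prop :=
  forall n, (n < N)%N -> has_moment n f /\ moment n f = 0.

(* [plus] selects the sign in front of the Hilbert transform. *)
Definition hartley_like (plus : bool) psi (t : R) : R[i] :=
  ((Num.sqrt 2)^-1)%:C *
  (if plus then psi t + hilbert_transform psi t
   else psi t - hilbert_transform psi t).

End HartleyLikeWavelets.

(* Main.v *)
Require Import Defs.
From mathcomp Require Import all_boot all_order all_algebra.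
From mathcomp Require Import complex.
From mathcomp Require Import all_classical all_reals all_analysis.
From mathcomp Require Import measurable_realfun ring lra.
Import Order.TTheory GRing.Theory Num.Theory.
Import numFieldNormedType.Exports.

(** Why the Hilbert transform keeps vanishing moments.

    Real and imaginary parts separate, so let [f] be real, square integrable,
    with [t^n f] integrable and of integral 0 for [n < N]; for [0 < N] this
    makes [f] integrable.  Let [h] be its Hilbert transform, for which [t^n h]
    is integrable when [n < N].  Put [p_s t = s / (t^2 + s^2)] and
    [q_s t = t / (t^2 + s^2)], so that [q_s + i p_s] is the Cauchy kernel
    [1 / (t - i s)].  Everything rests on the two identities
      [p_s * h = q_s * f]   and   [q_s * h = - p_s * f]   (convolutions),
    which say that the Cauchy integrals of [h] and [f] over the upper half-plane
    are proportional ([poisson_real_hilbert], [cpoisson_real_hilbert]).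

    Algebra then gives the theorem ([moments_of_cauchy]).  At the origin the
    identities read [int h p_s = - int f q_s] and [int h q_s = int f p_s].
    Since [t p_s = s q_s] and [t q_s = 1 - s p_s], they propagate from
    [t^n h, t^n f] to [t^n.+1 h, t^n.+1 f] as long as the moments of order [n]
    vanish; and multiplying the first one by [s] and letting [s] tend to
    infinity makes the moment of order [n] of [h] vanish, because [s p_s] and
    [s q_s] are bounded by 1 and tend to 1 and to 0.

    The analytic part is that the principal value exists almost everywhere and
    satisfies the first identity.  The functions [v_y = q_y * f] are Cauchy in
    L^2 as [y] tends to 0: since [q_y * q_s = - pi p_(y+s)] and [q_s] is odd,
    the inner product of [v_y] and [v_s] is [pi G (y + s)] where
    [G y = int f (p_y * f)], and [|v_y - v_s|^2] is [pi] times
    [G (2 y) - 2 G (y + s) + G (2 s)].  So [G] is midpoint convex;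
    being bounded above by [pi |f|^2] it is nonincreasing, thus convergent at 0
    ([conv_L2_cauchy]).  Along a sequence, [v_y] converges almost
    everywhere and in L^1 for the weight [1 / (1 + t^2)] to some [H], and
    [p_s * v_y = pi v_(s+y)] passes to the limit: [p_s * H = pi v_s]
    ([conj_boundary_value]).  At a Lebesgue point of [f] the truncated integral
    and [v_e] differ by o(1), since their kernels differ by an odd function
    bounded by [p_e]; at a Lebesgue point of [H], [pi v_e = p_e * H] tends to
    [pi H].  So the principal value is [H] almost everywhere
    ([principal_value]), and [h = H / pi]. *)

Set Implicit Arguments.
Unset Strict Implicit.
Unset Printing Implicit Defensive.

Local Open Scope classical_set_scope.
Local Open Scope ring_scope.

(** * Real-valued Lebesgue integration on the line *)

Section Toolbox.
Context {R : realType}.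
Local Notation mu := (@lebesgue_measure R).
Implicit Types (f g k : R -> R).

Lemma ae_mono (P Q : R -> Prop) : (forall x, P x -> Q x) ->
  {ae mu, forall x, P x} -> {ae mu, forall x, Q x}.
Proof. exact: (filterS (F := almost_everywhere mu) (Filter := ae_filter_ringOfSetsType mu)). Qed.

Lemma ae_and (P Q : R -> Prop) : {ae mu, forall x, P x} ->
  {ae mu, forall x, Q x} -> {ae mu, forall x, P x /\ Q x}.
Proof. exact: (filterI (F := almost_everywhere mu) (Filter := ae_filter_ringOfSetsType mu)). Qed.

Definition L1 f := mu.-integrable setT (EFin \o f).

Lemma L1_measurable f : L1 f -> measurable_fun setT f.
Proof. by move=> /integrableP[/measurable_EFinP]. Qed.

Lemma measurable_patch f (D : set R) : measurable D ->
  measurable_fun setT f -> measurable_fun setT (f \_ D).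
Proof.
by move=> mD mf; apply: (measurable_restrictT f mD).1; exact: measurable_funTS.
Qed.

Lemma L1_le f g : measurable_fun setT f -> L1 g ->
  (forall x, `|f x| <= g x) -> L1 f.
Proof.
move=> mf ig fg; apply: le_integrable ig => //; first exact/measurable_EFinP.
by move=> x _; rewrite /= lee_fin (le_trans (fg x))// ler_norm.
Qed.

Lemma L1D f g : L1 f -> L1 g -> L1 (fun x => f x + g x).
Proof.
by move=> fi gi; apply: eq_integrable (integrableD measurableT fi gi).
Qed.

Lemma L1B f g : L1 f -> L1 g -> L1 (fun x => f x - g x).
Proof.
by move=> fi gi; apply: eq_integrable (integrableB measurableT fi gi).
Qed.

Lemma L1Z (c : R) f : L1 f -> L1 (fun x => c * f x).
Proof.
by move=> fi; apply: eq_integrable (integrableZl measurableT c fi).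
Qed.

Lemma L1_norm f : L1 f -> L1 (fun x => `|f x|).
Proof. by move=> fi; apply: eq_integrable (integrable_abse fi). Qed.

Lemma L1_mul_bounded f k (C : R) : L1 f -> measurable_fun setT k ->
  (forall x, `|k x| <= C) -> L1 (fun x => f x * k x).
Proof.
move=> fi mk kC; apply: (L1_le _ (L1Z C (L1_norm fi))).
  by apply: measurable_funM => //; exact: L1_measurable.
by move=> x; rewrite normrM mulrC ler_wpM2r.
Qed.

Lemma L1_mul_sqr f g : measurable_fun setT f -> measurable_fun setT g ->
  L1 (fun x => f x ^+ 2) -> L1 (fun x => g x ^+ 2) ->
  L1 (fun x => f x * g x).
Proof.
move=> mf mg f2 g2; apply: (L1_le _ (L1D f2 g2)).
  exact: measurable_funM.
move=> x; rewrite ler_norml.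
have := sqr_ge0 (f x + g x); have := sqr_ge0 (f x - g x).
have := sqr_ge0 (f x); have := sqr_ge0 (g x).
by move=> *; apply/andP; split; nra.
Qed.

Lemma intD f g : L1 f -> L1 g ->
  \int[mu]_x (f x + g x) = \int[mu]_x f x + \int[mu]_x g x.
Proof. exact: RintegralD. Qed.

Lemma intB f g : L1 f -> L1 g ->
  \int[mu]_x (f x - g x) = \int[mu]_x f x - \int[mu]_x g x.
Proof. exact: RintegralB. Qed.

Lemma intZ (c : R) f : L1 f -> \int[mu]_x (c * f x) = c * \int[mu]_x f x.
Proof. exact: RintegralZl. Qed.

Lemma int_le f g : L1 f -> L1 g -> (forall x, f x <= g x) ->
  \int[mu]_x f x <= \int[mu]_x g x.
Proof. by move=> fi gi fg; apply: le_Rintegral. Qed.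

Lemma int_ge0 f : (forall x, 0 <= f x) -> 0 <= \int[mu]_x f x.
Proof. by move=> f0; apply: Rintegral_ge0. Qed.

Lemma norm_int_le f g : measurable_fun setT f -> L1 g ->
  (forall x, `|f x| <= g x) -> `|\int[mu]_x f x| <= \int[mu]_x g x.
Proof.
move=> mf ig fg; have fi := L1_le mf ig fg.
apply: (le_trans (le_normr_Rintegral measurableT fi)).
by apply: int_le => //; exact: L1_norm.
Qed.

Lemma ae_int f g : measurable_fun setT f -> measurable_fun setT g ->
  {ae mu, forall x, f x = g x} -> \int[mu]_x f x = \int[mu]_x g x.
Proof.
move=> mf mg fg; rewrite /Rintegral; congr fine.
apply: ae_eq_integral => //; [exact/measurable_EFinP|exact/measurable_EFinP|].
by move: fg; apply: ae_mono => x -> _.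
Qed.

Lemma EFin_int f : L1 f -> (\int[mu]_x f x)%:E = (\int[mu]_x (f x)%:E)%E.
Proof. by move=> fi; rewrite /Rintegral fineK//; exact: integrable_fin_num. Qed.

Lemma dominated_cvg_int_ae (f_ : nat -> R -> R) f g :
  (forall n, measurable_fun setT (f_ n)) -> measurable_fun setT f ->
  {ae mu, forall x, f_ n x @[n --> \oo] --> f x} ->
  L1 g -> {ae mu, forall x, forall n, `|f_ n x| <= g x} ->
  L1 f /\ (\int[mu]_x f_ n x) @[n --> \oo] --> \int[mu]_x f x.
Proof.
move=> mf_ mf ff ig fg.
have [|||||] := @dominated_convergence _ _ _ mu setT measurableT
   (fun n => EFin \o f_ n) (EFin \o f) (EFin \o g).
- by move=> n; apply: (measurable_EFinP _ _).2; exact: mf_.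
- by apply: (measurable_EFinP _ _).2.
- move: ff; apply: ae_mono => x fx _; rewrite /comp.
  apply: (cvg_EFin (f := fun n => (f_ n x)%:E)) => //.
  exact: nearW.
- by [].
- by move: fg; apply: ae_mono => x fg n _; rewrite /= lee_fin.
move=> iff _ h; split; first exact: iff.
apply: fine_cvg; rewrite EFin_int//; exact: h.
Qed.

Lemma dominated_cvg_int (f_ : nat -> R -> R) f g :
  (forall n, measurable_fun setT (f_ n)) -> measurable_fun setT f ->
  (forall x, f_ n x @[n --> \oo] --> f x) ->
  L1 g -> (forall n x, `|f_ n x| <= g x) ->
  (\int[mu]_x f_ n x) @[n --> \oo] --> \int[mu]_x f x.
Proof.
move=> mf_ mf ff ig fg.
by apply: (dominated_cvg_int_ae mf_ mf _ ig _).2; apply: aeW.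
Qed.

End Toolbox.


(** * Fubini, reflection and the fundamental theorem of calculus on the line *)

Section Fubini.
Context {R : realType}.
Local Notation mu := (@lebesgue_measure R).
Implicit Types (f g k : R -> R) (F : R -> R -> R).

(** Integrability on the plane comes from Tonelli, integrating first in the
    variable [x] of the kernel [k].  All sections are required to be integrable
    because the inner integrals are real numbers, meaningless otherwise. *)
Lemma fubini_dominated F f (k : R -> R -> R) (C : R) :
  measurable_fun setT (fun z : R * R => F z.1 z.2) ->
  L1 f -> (forall a, L1 (k ^~ a)) ->
  (forall a, \int[mu]_x k x a <= C) ->
  (forall x a, `|F x a| <= `|f a| * k x a) ->
  (forall x, L1 (F x)) -> (forall a, L1 (F ^~ a)) ->
  L1 (fun x => \int[mu]_a F x a) /\
     (\int[mu]_x \int[mu]_a F x a = \int[mu]_a \int[mu]_x F x a).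
Proof.
move=> mF if1 ik kC FB iF1 iF2.
pose G (z : R * R) := (F z.1 z.2)%:E.
have mG : measurable_fun setT G by exact/measurable_EFinP.
have iG : (mu \x mu)%E.-integrable setT G.
  apply/integrable21ltyP => //.
  apply: (@le_lt_trans _ _ (\int[mu]_a (`|f a| * C)%:E)%E); last first.
    have : L1 (fun a => `|f a| * C).
      have := L1Z C (L1_norm if1).
      by apply: eq_integrable => // x _ /=; rewrite mulrC.
    by move=> /integrable_lty; apply.
  apply: ge0_le_integral => //=.
  - by move=> a _; apply: integral_ge0.
  - have mG' : measurable_fun setT (abse \o G) by exact: measurableT_comp.
    have G0 z : (0 <= (abse \o G) z)%E by exact: abse_ge0.
    exact: (measurable_fun_fubini_tonelli_G (m1 := mu) _ mG' G0).
  - apply/measurable_EFinP; apply: measurable_funM => //.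
    by apply: measurableT_comp => //; exact: L1_measurable.
  - move=> a _; apply: (@le_trans _ _ (\int[mu]_x (`|f a| * k x a)%:E)%E).
      apply: ge0_le_integral => //=.
      + apply/measurable_EFinP; apply: measurableT_comp => //.
        exact: L1_measurable (iF2 a).
      + apply/measurable_EFinP; apply: measurable_funM => //.
        exact: L1_measurable (ik a).
      + by move=> x _; rewrite lee_fin.
    rewrite -EFin_int; last exact: L1Z.
    by rewrite intZ// lee_fin ler_wpM2l.
have E1 : (fun x => (\int[mu]_a F x a)%:E) = (fun x => \int[mu]_a G (x, a))%E.
  by apply/funext => x; rewrite EFin_int.
have E2 : (fun a => (\int[mu]_x F x a)%:E) = (fun a => \int[mu]_x G (x, a))%E.
  by apply/funext => x; rewrite EFin_int.
split.
- by rewrite /L1 /comp E1; exact: (integrable_fubini_F iG).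
- by rewrite /Rintegral E1 E2; congr fine; exact: Fubini.
Qed.

(** Lebesgue measure is determined by the length of intervals, which the
    reflection [t |-> c - t] preserves. *)
Lemma int_reflect (c : R) f : measurable_fun setT f -> L1 (fun t => f (c - t)) ->
  \int[mu]_t f (c - t) = \int[mu]_t f t.
Proof.
move=> mf fi; pose phi (t : R) : R := c - t.
have mphi : measurable_fun setT phi by exact: measurable_funB.
rewrite /Rintegral; congr fine; symmetry.
transitivity (\int[pushforward mu (phi : measurableTypeR R -> measurableTypeR R)]_t (f t)%:E)%E.
  apply: eq_measure_integral => A mA _.
  apply: lebesgue_measure_unique => // _ [[a b] _ <-].
  change (mu `]a, b]%classic = mu (phi @^-1` `]a, b]%classic)).
  have -> : phi @^-1` `]a, b]%classic = `[c - b, c - a[%classic.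
    apply/seteqP; split => t /=; rewrite !in_itv/= /phi => /andP[? ?]; apply/andP; split; lra.
  rewrite !lebesgue_measure_itv/= !lte_fin.
  have -> : (c - b < c - a) = (a < b) by apply/idP/idP => ?; lra.
  by case: ifP => // _; rewrite -!EFinB; congr EFin; ring.
rewrite integral_pushforward//=.
exact/measurable_EFinP.
Qed.

Lemma int_odd (c : R) f : L1 f -> (forall t, f (c - t) = - f t) ->
  \int[mu]_t f t = 0.
Proof.
move=> fi fo.
have fi' : L1 (fun t => f (c - t)).
  have := L1Z (-1) fi; apply: eq_integrable => // t _ /=.
  by rewrite fo mulN1r.
have := int_reflect (L1_measurable fi) fi'.
under eq_Rintegral do rewrite fo -mulN1r.
rewrite intZ//; lra.
Qed.

Lemma FTC_interval (g F : R -> R) (n : nat) : continuous g ->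
  (forall x : R, is_derive x 1 F (g x)) ->
  \int[mu]_x (g \_ `[- n.+1%:R, n.+1%:R]%classic) x = F n.+1%:R - F (- n.+1%:R).
Proof.
move=> cg dF.
have cF x : {for x, continuous F}.
  by apply/differentiable_continuous/derivable1_diffP; exact: (@ex_derive _ _ _ _ _ _ _ (dF x)).
rewrite -Rintegral_mkcond /Rintegral (@continuous_FTC2 _ _ F)//.
- by rewrite gtrN// ltr0n.
- exact: continuous_subspaceT.
- split.
  + by move=> x _; exact: (@ex_derive _ _ _ _ _ _ _ (dF x)).
  + by apply: cvg_at_right_filter; exact: cF.
  + by apply: cvg_at_left_filter; exact: cF.
- by move=> x _; rewrite derive1E; exact: (@derive_val _ _ _ _ _ _ _ (dF x)).
Qed.

Lemma L1_patch_interval (g : R -> R) (a b : R) : continuous g ->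
  L1 (g \_ `[a, b]%classic).
Proof.
move=> cg; have ig : mu.-integrable `[a, b]%classic (EFin \o g).
  apply: continuous_compact_integrable; first exact: segment_compact.
  exact: continuous_subspaceT.
rewrite /L1 -restrict_EFin; apply: (integrable_mkcond _ _).1; last exact: ig.
exact: measurable_itv.
Qed.

Lemma cvg_patch_interval (g : R -> R) x :
  (g \_ `[- n.+1%:R, n.+1%:R]%classic) x @[n --> \oo] --> g x.
Proof.
apply: cvg_near_cst; near=> n.
rewrite patchE mem_set//= in_itv/= -ler_norml.
rewrite (@le_trans _ _ n%:R) ?ler_nat//; near: n; exact: nbhs_infty_ger.
Unshelve. all: by end_near. Qed.

(** The signs of [g] are arbitrary, so integrability is assumed rather than
    deduced; the integral is the limit of those over [[-n, n]]. *)
Lemma FTC_line (g F : R -> R) (a b : R) : continuous g -> L1 g ->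
  (forall x : R, is_derive x 1 F (g x)) ->
  F (- x) @[x --> +oo] --> a -> F x @[x --> +oo] --> b ->
  \int[mu]_x g x = b - a.
Proof.
move=> cg ig dF Fa Fb.
pose gn (n : nat) := g \_ `[- n.+1%:R, n.+1%:R]%classic.
have h1 : \int[mu]_x gn n x @[n --> \oo] --> \int[mu]_x g x.
  apply: (@dominated_cvg_int R gn g (fun x => `|g x|)).
  - move=> n; apply: measurable_patch; first exact: measurable_itv.
    exact: L1_measurable.
  - exact: L1_measurable.
  - by move=> x; exact: cvg_patch_interval.
  - exact: L1_norm.
  - by move=> n x; rewrite /gn patchE; case: ifP => //= _; rewrite normr0.
have ny : (n.+1%:R : R) @[n --> \oo] --> +oo.
  by rewrite (cvg_shiftS (fun n => n%:R : R)); exact: cvgr_idn.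
have h2 : (F n.+1%:R - F (- n.+1%:R)) @[n --> \oo] --> b - a.
  apply: cvgB; first exact: (cvg_comp _ _ ny Fb).
  exact: (cvg_comp _ _ ny Fa).
have E n : \int[mu]_x gn n x = F n.+1%:R - F (- n.+1%:R) by exact: FTC_interval.
rewrite (funext E) in h1.
exact: (cvg_unique _ h1 h2).
Qed.

End Fubini.


(** * The Poisson kernel, its conjugate, and their convolutions *)

Section Kernels.
Context {R : realType}.
Local Notation mu := (@lebesgue_measure R).
Implicit Types (f g k : R -> R).

(** Fatou's lemma as an integrability criterion, used to integrate nonnegative
    functions with bounded primitives. *)
Lemma L1_fatou (g_ : nat -> R -> R) g (C : R) :
  (forall n, L1 (g_ n)) -> (forall n x, 0 <= g_ n x) ->
  measurable_fun setT g -> (forall x, g_ n x @[n --> \oo] --> g x) ->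
  (forall n, \int[mu]_x g_ n x <= C) -> L1 g.
Proof.
move=> ig_ g0 mg gg gC; apply/integrableP; split; first by apply: (measurable_EFinP _ _).2.
apply: (@le_lt_trans _ _ C%:E); last exact: ltry.
have E x : (`|(EFin \o g) x|)%E = limn_einf (fun n => (g_ n x)%:E).
  have cg : (g_ n x)%:E @[n --> \oo] --> (g x)%:E.
    by apply: (cvg_EFin (f := fun n => (g_ n x)%:E)); [exact: nearW|exact: gg].
  have [-> _] := cvg_limn_einf_sup cg.
  rewrite gee0_abs// lee_fin.
  by apply: (cvgr_to_ge (gg x)); exact: nearW.
under eq_integral do rewrite E.
have := @fatou _ _ _ mu setT measurableT (fun n => EFin \o g_ n).
move=> /(_ _ _)/le_trans; apply.
- by move=> n; apply: (measurable_EFinP _ _).2; exact: L1_measurable.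
- by move=> n x _; rewrite lee_fin.
rewrite limn_einf_lim; apply: lime_le; first exact: is_cvg_einfs.
apply: nearW => n; apply: (@le_trans _ _ (\int[mu]_x (g_ n x)%:E)%E).
  by apply: ereal_inf_lbound; exists n => /=.
by rewrite -EFin_int// lee_fin.
Qed.

Lemma is_derive_atan_affine (a y t : R) :
  is_derive t 1 (fun t : R => atan (y * (t - a))) (y / (1 + (y * (t - a)) ^+ 2)).
Proof.
have d1 : is_derive t 1 (fun t : R => y * (t - a)) y.
  have -> : (fun t : R => y * (t - a)) = y \*: (id - cst a) by [].
  by apply: is_derive_eq; rewrite subr0 /GRing.scale /= mulr1.
by apply: is_derive_eq; rewrite mulrC.
Qed.


Lemma quad_gt0 (y t : R) : 0 < y -> 0 < t ^+ 2 + y ^+ 2.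
Proof. by move=> y0; rewrite ltr_wpDl ?sqr_ge0// exprn_gt0. Qed.

Lemma is_derive_quad (a y t : R) :
  is_derive t 1 (fun t : R => (t - a) ^+ 2 + y ^+ 2) (2 * (t - a)).
Proof.
have -> : (fun t : R => (t - a) ^+ 2 + y ^+ 2) = (id - cst a) ^+ 2 + cst (y ^+ 2) by [].
apply: is_derive_eq; rewrite /GRing.scale /=.
by rewrite expr1 subr0 mulr1 addr0.
Qed.

Lemma is_derive_ln_quad (a y t : R) : 0 < y ->
  is_derive t 1 (fun t : R => ln ((t - a) ^+ 2 + y ^+ 2)) (2 * (t - a) / ((t - a) ^+ 2 + y ^+ 2)).
Proof.
move=> y0.
have d1 := is_derive_quad a y t.
have d2 := is_derive1_ln (quad_gt0 (t - a) y0).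
by apply: is_derive_eq; rewrite mulrC.
Qed.

(** The Poisson kernel of the upper half-plane, without the factor [1 / pi]. *)
Definition poisson (y t : R) : R := y / (t ^+ 2 + y ^+ 2).
(** The conjugate Poisson kernel: [cpoisson y t + i poisson y t] is the Cauchy
    kernel [1 / (t - i y)]. *)
Definition cpoisson (y t : R) : R := t / (t ^+ 2 + y ^+ 2).

Lemma poisson_ge0 y t : 0 < y -> 0 <= poisson y t.
Proof. by move=> y0; rewrite divr_ge0// ltW//; exact: quad_gt0. Qed.

Lemma poissonN y t : poisson y (- t) = poisson y t. Proof. by rewrite /poisson sqrrN. Qed.
Lemma cpoissonN y t : cpoisson y (- t) = - cpoisson y t.
Proof. by rewrite /cpoisson sqrrN mulNr. Qed.

Lemma continuous_quadV (y a : R) : 0 < y ->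
  continuous (fun t : R => ((t - a) ^+ 2 + y ^+ 2)^-1).
Proof.
move=> y0 t; apply: cvgV; first by rewrite gt_eqF// quad_gt0.
apply: cvgD; last exact: cvg_cst.
apply: (@cvg_comp _ _ _ (fun t => t - a) (fun u => u ^+ 2)); last exact: exprn_continuous.
by apply: cvgB => //; exact: cvg_cst.
Qed.

Lemma continuous_poisson y a : 0 < y -> continuous (fun t => poisson y (t - a)).
Proof.
by move=> y0 t; apply: cvgM; [exact: cvg_cst|exact: continuous_quadV].
Qed.

Lemma continuous_cpoisson y a : 0 < y -> continuous (fun t => cpoisson y (t - a)).
Proof.
move=> y0 t; apply: cvgM; last exact: continuous_quadV.
by apply: cvgB => //; exact: cvg_cst.
Qed.

Lemma measurable_poisson y : 0 < y -> measurable_fun setT (poisson y).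
Proof.
move=> y0; apply: continuous_measurable_fun => t.
have -> : poisson y = (fun u => poisson y (u - 0)) by apply/funext => u; rewrite subr0.
exact: continuous_poisson.
Qed.

Lemma measurable_cpoisson y : 0 < y -> measurable_fun setT (cpoisson y).
Proof.
move=> y0; apply: continuous_measurable_fun => t.
have -> : cpoisson y = (fun u => cpoisson y (u - 0)) by apply/funext => u; rewrite subr0.
exact: continuous_cpoisson.
Qed.

Lemma poisson_decay y t : 0 < y -> t != 0 -> `|poisson y t| <= `|t|^-1.
Proof.
move=> y0 t0; rewrite ger0_norm ?poisson_ge0// /poisson -normr_gt0 in t0 *.
have q0 := quad_gt0 t y0.
rewrite -[leRHS]mul1r ler_pdivrMr// mulrAC ler_pdivlMr// mul1r -(real_normK (num_real t)).
have := sqr_ge0 (`|t| - y); nra.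
Qed.

Lemma cpoisson_decay y t : 0 < y -> t != 0 -> `|cpoisson y t| <= `|t|^-1.
Proof.
move=> y0 t0; rewrite -normr_gt0 in t0.
have q0 := quad_gt0 t y0.
rewrite /cpoisson normrM normfV (ger0_norm (ltW q0)).
rewrite -[leRHS]mul1r ler_pdivrMr// mulrAC ler_pdivlMr// mul1r -(real_normK (num_real t)).
nra.
Qed.

Lemma decay_cvg0 k (a : R) : (forall t, t != 0 -> `|k t| <= `|t|^-1) ->
  k (x - a) @[x --> +oo] --> 0.
Proof.
move=> kd; apply/cvgrPdist_le => /= e e0; near=> x.
have xa : e^-1 < x - a.
  by rewrite ltrBrDr; near: x; apply: nbhs_pinfty_gt; exact: num_real.
have xa0 : 0 < x - a by apply: lt_trans xa; rewrite invr_gt0.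
rewrite sub0r normrN (le_trans (kd _ _)) ?gt_eqF//.
by rewrite gtr0_norm// -[e]invrK lef_pV2 ?posrE ?invr_gt0//; exact: ltW.
Unshelve. all: by end_near. Qed.

(** The quotient of the two quadratic polynomials is 1 plus a combination of
    the two kernels, and these vanish at infinity. *)
Lemma cvg0_ln_quad (a b y s : R) : 0 < y -> 0 < s ->
  ln ((x - b) ^+ 2 + s ^+ 2) - ln ((x - a) ^+ 2 + y ^+ 2) @[x --> +oo] --> 0.
Proof.
move=> y0 s0.
pose al := 2 * (a - b); pose be := (a - b) ^+ 2 + s ^+ 2 - y ^+ 2.
have E x : ln ((x - b) ^+ 2 + s ^+ 2) - ln ((x - a) ^+ 2 + y ^+ 2) =
    ln (1 + (al * cpoisson y (x - a) + be / y * poisson y (x - a))).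
  have p1 := quad_gt0 (x - b) s0; have p2 := quad_gt0 (x - a) y0.
  rewrite -ln_div ?posrE//; congr ln.
  rewrite /al /be /cpoisson /poisson; field.
  by rewrite !gt_eqF.
rewrite (funext E) -[X in _ --> X]ln1.
apply: (@cvg_comp _ _ _
  (fun x => 1 + (al * cpoisson y (x - a) + be / y * poisson y (x - a)))
  (@ln R) _ (nbhs (1:R))); last first.
  exact: continuous_ln.
have : 1 + (al * cpoisson y (x - a) + be / y * poisson y (x - a)) @[x --> +oo] -->
    1 + (al * 0 + be / y * 0).
  apply: cvgD; first exact: cvg_cst.
  by apply: cvgD; apply: cvgMr; apply: decay_cvg0 => t;
    [exact: cpoisson_decay|exact: poisson_decay].
by rewrite !mulr0 !addr0.
Qed.

Lemma cvg_atan_affine (a y : R) : 0 < y ->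
  atan (y^-1 * (x - a)) @[x --> +oo] --> pi / 2.
Proof.
move=> y0; apply: (@cvg_comp _ _ _ (fun x => y^-1 * (x - a)) (@atan R) _ _ _ _ (@cvgy_atan R)).
apply/cvgryPge => M; near=> x.
rewrite ler_pdivlMl// lerBrDr; near: x; apply: nbhs_pinfty_ge; exact: num_real.
Unshelve. all: by end_near. Qed.

(** The primitive is an arctangent, bounded by [pi / 2]. *)
Lemma L1_poisson (y a : R) : 0 < y -> L1 (fun t => poisson y (t - a)).
Proof.
move=> y0.
pose F t := atan (y^-1 * (t - a)).
have dF (t : R) : is_derive t 1 F (poisson y (t - a)).
  have p2 := quad_gt0 (t - a) y0.
  have d := is_derive_atan_affine a y^-1 t.
  apply: is_derive_eq.
  rewrite /poisson; field.
  by rewrite !gt_eqF.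
have cp := @continuous_poisson y a y0.
apply: (@L1_fatou (fun n => (fun t => poisson y (t - a)) \_ `[- n.+1%:R, n.+1%:R]%classic) _ pi).
- by move=> n; exact: L1_patch_interval.
- by move=> n x; rewrite patchE; case: ifP => // _; exact: poisson_ge0.
- exact: continuous_measurable_fun.
- by move=> x; exact: cvg_patch_interval.
- move=> n; rewrite (@FTC_interval _ _ F)//.
  have := atan_ltpi2 (y^-1 * (n.+1%:R - a)); have := atan_gtNpi2 (y^-1 * (- n.+1%:R - a)).
  rewrite /F; lra.
Qed.

(** Products of two kernels have this shape by partial fractions.  The
    difference of conjugate kernels has a logarithmic primitive vanishing at
    both ends, so only the arctangents contribute. *)
Lemma int_partial_fractions (A B C a b y s : R) g : 0 < y -> 0 < s -> L1 g ->
  (forall t, g t = A * (cpoisson s (t - b) - cpoisson y (t - a)) +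
    B * poisson s (t - b) + C * poisson y (t - a)) ->
  \int[mu]_t g t = pi * (B + C).
Proof.
move=> y0 s0 ig gE.
pose F (t : R) := A * (2^-1 * (ln ((t - b) ^+ 2 + s ^+ 2) - ln ((t - a) ^+ 2 + y ^+ 2))) +
  B * atan (s^-1 * (t - b)) + C * atan (y^-1 * (t - a)).
have cg : continuous g.
  rewrite (funext gE) => t; apply: cvgD.
    apply: cvgD.
      apply: cvgMr; apply: cvgB; exact: continuous_cpoisson.
    apply: cvgMr; exact: continuous_poisson.
  apply: cvgMr; exact: continuous_poisson.
have dF (t : R) : is_derive t 1 F (g t).
  have p1 := quad_gt0 (t - b) s0; have p2 := quad_gt0 (t - a) y0.
  have l1 := is_derive_ln_quad b t s0; have l2 := is_derive_ln_quad a t y0.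
  have a1 := is_derive_atan_affine b s^-1 t.
  have a2 := is_derive_atan_affine a y^-1 t.
  have -> : F = A \*: (2^-1 \*: ((fun t : R => ln ((t - b) ^+ 2 + s ^+ 2)) -
       (fun t : R => ln ((t - a) ^+ 2 + y ^+ 2)))) +
     B \*: (fun t : R => atan (s^-1 * (t - b))) + C \*: (fun t : R => atan (y^-1 * (t - a))) by [].
  apply: is_derive_eq; rewrite gE /GRing.scale/= /cpoisson /poisson; field.
  by rewrite !gt_eqF.
rewrite (@FTC_line _ g F (A * (2^-1 * 0) + B * (- (pi / 2)) + C * (- (pi / 2)))
   (A * (2^-1 * 0) + B * (pi / 2) + C * (pi / 2)))//; first by field.
  have E u v x : ln ((- x - u) ^+ 2 + v ^+ 2) = ln ((x - - u) ^+ 2 + v ^+ 2) :> R.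
    by congr ln; ring.
  have E' u v x : atan (v * (- x - u)) = - atan (v * (x - - u)) :> R.
    by rewrite -atanN; congr atan; ring.
  rewrite /F; under eq_fun do rewrite !E !E'.
  apply: cvgD; first apply: cvgD.
  - by do 2 apply: cvgMr; exact: cvg0_ln_quad.
  - by apply: cvgMr; apply: cvgN; exact: cvg_atan_affine.
  - by apply: cvgMr; apply: cvgN; exact: cvg_atan_affine.
apply: cvgD; first apply: cvgD.
- by do 2 apply: cvgMr; exact: cvg0_ln_quad.
- by apply: cvgMr; exact: cvg_atan_affine.
- by apply: cvgMr; exact: cvg_atan_affine.
Qed.

Lemma int_poisson y a : 0 < y -> \int[mu]_t poisson y (t - a) = pi.
Proof.
move=> y0; rewrite (@int_partial_fractions 0 0 1 a a y y)//; first by ring.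
  exact: L1_poisson.
by move=> t; ring.
Qed.

Lemma cpoisson_sqr_le y t : 0 < y -> cpoisson y t ^+ 2 <= y^-1 * poisson y t.
Proof.
move=> y0; have p := quad_gt0 t y0.
rewrite /cpoisson /poisson expr_div_n mulrA mulVf ?gt_eqF// mul1r ler_pdivrMr ?exprn_gt0//.
rewrite expr2 mulKf ?gt_eqF//. have := sqr_ge0 y; nra.
Qed.

Lemma poisson_sqr_le y t : 0 < y -> poisson y t ^+ 2 <= y^-1 * poisson y t.
Proof.
move=> y0; have p := quad_gt0 t y0.
rewrite /poisson expr_div_n mulrA mulVf ?gt_eqF// mul1r ler_pdivrMr ?exprn_gt0//.
rewrite expr2 mulKf ?gt_eqF//. have := sqr_ge0 t; nra.
Qed.

(** The two kernels satisfy the same size estimates; this predicate states them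
    once for both. *)
Definition cauchy_part (y : R) k := k = poisson y \/ k = cpoisson y.

Lemma poisson_part y : cauchy_part y (poisson y). Proof. by left. Qed.
Lemma cpoisson_part y : cauchy_part y (cpoisson y). Proof. by right. Qed.

(** The square of either kernel is at most [poisson y / y]. *)
Lemma cauchy_part_sqr y k a : 0 < y -> cauchy_part y k ->
  L1 (fun t => k (t - a) ^+ 2) /\ \int[mu]_t (k (t - a) ^+ 2) <= pi / y.
Proof.
move=> y0 kk.
have mk : measurable_fun setT k.
  by case: kk => ->; [exact: measurable_poisson|exact: measurable_cpoisson].
have kle t : k t ^+ 2 <= y^-1 * poisson y t.
  by case: kk => ->; [exact: poisson_sqr_le|exact: cpoisson_sqr_le].
have i : L1 (fun t => k (t - a) ^+ 2).
  apply: (L1_le _ (L1Z y^-1 (L1_poisson a y0))).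
    apply: measurable_funX; apply: measurableT_comp => //; exact: measurable_funB.
  by move=> t; rewrite ger0_norm ?sqr_ge0.
split=> //.
rewrite mulrC -(int_poisson a y0) -intZ; last exact: L1_poisson.
by apply: int_le => //; apply: L1Z; exact: L1_poisson.
Qed.

Lemma is_derive_cpoisson (y a t : R) : 0 < y ->
  is_derive t 1 (fun t => cpoisson y (t - a))
    ((y ^+ 2 - (t - a) ^+ 2) / ((t - a) ^+ 2 + y ^+ 2) ^+ 2).
Proof.
move=> y0; have p := quad_gt0 (t - a) y0.
have d1 := is_derive_quad a y t.
have d2 := @is_deriveV R (fun t : R => (t - a) ^+ 2 + y ^+ 2) t _ 1 (lt0r_neq0 p) d1.
have -> : (fun t => cpoisson y (t - a)) =
  (id - cst a) * (fun t => ((t - a) ^+ 2 + y ^+ 2)^-1) by [].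
apply: is_derive_eq; rewrite /GRing.scale /=.
have -> : (id - cst a) t = t - a by [].
rewrite subr0; field.
by rewrite gt_eqF.
Qed.

(** The integrand is half the difference between [1 / ((t - a)^2 + y^2)] and the
    derivative of [cpoisson y (t - a)]. *)
Lemma int_cpoisson_sqr (y a : R) : 0 < y -> \int[mu]_t (cpoisson y (t - a) ^+ 2) = pi / (2 * y).
Proof.
move=> y0.
have [i2 _] := cauchy_part_sqr a y0 (cpoisson_part _).
pose F (t : R) := 2^-1 * (y^-1 * atan (y^-1 * (t - a)) - cpoisson y (t - a)).
have dF (t : R) : is_derive t 1 F (cpoisson y (t - a) ^+ 2).
  have p := quad_gt0 (t - a) y0.
  have d1 := is_derive_cpoisson a t y0.
  have a2 := is_derive_atan_affine a y^-1 t.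
  have -> : F = 2^-1 \*: (y^-1 \*: (fun t : R => atan (y^-1 * (t - a))) -
      (fun t => cpoisson y (t - a))) by [].
  apply: is_derive_eq; rewrite /GRing.scale/= /cpoisson; field.
  by rewrite !gt_eqF.
have E x : F (- x) = - (2^-1 * (y^-1 * atan (y^-1 * (x - - a)) - cpoisson y (x - - a))).
  have e : - x - a = - (x - - a) by ring.
  by rewrite /F e mulrN atanN cpoissonN; ring.
rewrite (@FTC_line _ _ F (- (2^-1 * (y^-1 * (pi / 2) - 0))) (2^-1 * (y^-1 * (pi / 2) - 0)))//.
- by field; rewrite gt_eqF.
- move=> t; apply: (@cvg_comp _ _ _ (fun t => cpoisson y (t - a)) (fun u => u ^+ 2));
    [exact: continuous_cpoisson|exact: exprn_continuous].
- under eq_fun do rewrite E.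
  apply: cvgN; apply: cvgMr; apply: cvgB; first by apply: cvgMr; exact: cvg_atan_affine.
  by apply: decay_cvg0 => t; exact: cpoisson_decay.
- apply: cvgMr; apply: cvgB; first by apply: cvgMr; exact: cvg_atan_affine.
  by apply: decay_cvg0 => t; exact: cpoisson_decay.
Qed.

(** With [d = a - b], the coefficients below come from adding the partial
    fraction decompositions of [1 / ((t - b - i s) (t - a - i y))] and
    [1 / ((t - b - i s) (t - a + i y))], whose denominators are
    [d^2 + (s - y)^2] and [d^2 + (s + y)^2].  The first one degenerates when the
    two kernels coincide, a case computed separately. *)
Lemma int_cpoisson_cpoisson y s a b : 0 < y -> 0 < s ->
  \int[mu]_t (cpoisson s (t - b) * cpoisson y (t - a)) = pi * poisson (s + y) (a - b).
Proof.
move=> y0 s0.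
have [i1 _] := cauchy_part_sqr b s0 (cpoisson_part _).
have [i2 _] := cauchy_part_sqr a y0 (cpoisson_part _).
have ig : L1 (fun t => cpoisson s (t - b) * cpoisson y (t - a)).
  by apply: L1_mul_sqr => //; apply: continuous_measurable_fun; exact: continuous_cpoisson.
(* the kernels coincide exactly when the first denominator vanishes *)
have [dg|dg] := eqVneq ((a - b) ^+ 2 + (s - y) ^+ 2) 0.
  have /andP[/eqP ab /eqP sy] : (a - b == 0) && (s - y == 0).
    by move/eqP: dg; rewrite paddr_eq0 ?sqr_ge0// !sqrf_eq0.
  have -> : b = a by lra.
  have -> : s = y by lra.
  rewrite subrr /poisson expr0n add0r; under eq_Rintegral do rewrite -expr2.
  by rewrite int_cpoisson_sqr//; field; rewrite gt_eqF ?addr_gt0// gt_eqF.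
have np : (a - b) ^+ 2 + (s + y) ^+ 2 != 0 by rewrite gt_eqF// quad_gt0// addr_gt0.
pose d := a - b.
pose N1 := d ^+ 2 + (s - y) ^+ 2; pose N2 := d ^+ 2 + (s + y) ^+ 2.
rewrite (@int_partial_fractions (- (d / N1 + d / N2) / 2)
   (((s - y) / N1 + (s + y) / N2) / 2) ((- ((s - y) / N1) + (s + y) / N2) / 2) a b y s)//.
  by rewrite /poisson /N1 /N2 /d; field; rewrite np dg.
move=> t.
have p1 := quad_gt0 (t - b) s0; have p2 := quad_gt0 (t - a) y0.
rewrite /cpoisson /poisson /N1 /N2 /d; field.
by rewrite np dg !gt_eqF.
Qed.

(** Same decomposition, imaginary part.  The hypothesis [s != y] keeps the
    poles [x + i s] and [a + i y] apart; taking a limit or splitting a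
    parameter unevenly always allows it. *)
Lemma int_poisson_cpoisson y s a x : 0 < y -> 0 < s -> s != y ->
  \int[mu]_t (poisson s (x - t) * cpoisson y (t - a)) = pi * cpoisson (s + y) (x - a).
Proof.
move=> y0 s0 sy.
have [i1 _] := cauchy_part_sqr x s0 (poisson_part _).
have [i2 _] := cauchy_part_sqr a y0 (cpoisson_part _).
have ig : L1 (fun t => poisson s (t - x) * cpoisson y (t - a)).
  by apply: L1_mul_sqr => //; apply: continuous_measurable_fun;
    [exact: continuous_poisson|exact: continuous_cpoisson].
under eq_Rintegral do rewrite -poissonN opprB.
have dg : (a - x) ^+ 2 + (s - y) ^+ 2 != 0.
  by rewrite paddr_eq0 ?sqr_ge0// !sqrf_eq0 negb_and subr_eq0 (subr_eq0 s) sy orbT.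
have np : (a - x) ^+ 2 + (s + y) ^+ 2 != 0 by rewrite gt_eqF// quad_gt0// addr_gt0.
pose d := a - x.
pose N1 := d ^+ 2 + (s - y) ^+ 2; pose N2 := d ^+ 2 + (s + y) ^+ 2.
rewrite (@int_partial_fractions (- ((s - y) / N1 + (s + y) / N2) / 2)
   (- (d / N1 + d / N2) / 2) ((d / N1 - d / N2) / 2) a x y s)//.
  rewrite -[x - a]opprB cpoissonN.
  by rewrite /cpoisson /N1 /N2 /d; field; rewrite np dg.
move=> t.
have p1 := quad_gt0 (t - x) s0; have p2 := quad_gt0 (t - a) y0.
rewrite /cpoisson /poisson /N1 /N2 /d; field.
by rewrite np dg !gt_eqF.
Qed.
End Kernels.


(** * Conjugate Poisson integrals form a Cauchy family in L^2 *)

Section Conv.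
Context {R : realType}.
Local Notation mu := (@lebesgue_measure R).
Implicit Types (f g k : R -> R).

Definition conv k f (x : R) : R := \int[mu]_b (f b * k (x - b)).

Lemma measurable_cauchy_part y k : 0 < y -> cauchy_part y k -> measurable_fun setT k.
Proof. by move=> y0 [] ->; [exact: measurable_poisson|exact: measurable_cpoisson]. Qed.

Lemma cauchy_part_bounded (y t : R) k : 0 < y -> cauchy_part y k -> `|k t| <= y^-1.
Proof.
move=> y0 kk; rewrite -ler_sqr ?nnegrE ?invr_ge0 ?(ltW y0)// real_normK ?num_real//.
have q0 := quad_gt0 t y0.
have h : poisson y t <= y^-1.
  rewrite /poisson ler_pdivrMr// mulrC ler_pdivlMr//; have := sqr_ge0 t; nra.
apply: (@le_trans _ _ (y^-1 * poisson y t)).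
  by case: kk => ->; [exact: poisson_sqr_le|exact: cpoisson_sqr_le].
by rewrite expr2 ler_wpM2l// invr_ge0 ltW.
Qed.

Lemma measurable_subr (a : R) k : measurable_fun setT k ->
  measurable_fun setT (fun t : R => k (t - a)).
Proof. by move=> mk; apply: measurableT_comp => //; exact: measurable_funB. Qed.

Lemma measurable_rsub (a : R) k : measurable_fun setT k ->
  measurable_fun setT (fun t : R => k (a - t)).
Proof. by move=> mk; apply: measurableT_comp => //; exact: measurable_funB. Qed.

Lemma measurable_sub2 k : measurable_fun setT k ->
  measurable_fun setT (fun z : R * R => k (z.1 - z.2)).
Proof. by move=> mk; apply: measurableT_comp => //; exact: measurable_funB. Qed.

Lemma L1_conv (x y : R) k f : 0 < y -> cauchy_part y k -> L1 f -> L1 (fun b => f b * k (x - b)).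
Proof.
move=> y0 kk fi; apply: (@L1_mul_bounded _ _ _ y^-1) => //.
  by apply: measurable_rsub; exact: measurable_cauchy_part kk.
by move=> b; exact: cauchy_part_bounded.
Qed.

(** A kernel is only square integrable, so the test function [g] has to be
    square integrable as well; the product is then dominated by
    [g^2 + k^2], uniformly in the translation. *)
Lemma conv_fubini (y : R) f g k : 0 < y -> cauchy_part y k -> L1 f ->
  measurable_fun setT g -> L1 (fun x => g x ^+ 2) ->
  L1 (fun x => g x * conv k f x) /\
  \int[mu]_x (g x * conv k f x) = \int[mu]_b (f b * \int[mu]_x (g x * k (x - b))).
Proof.
move=> y0 kk fi mg g2.
have mk := measurable_cauchy_part y0 kk.
have igk b : L1 (fun x => g x * k (x - b)).
  apply: L1_mul_sqr => //; first exact: measurable_subr.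
  exact: (cauchy_part_sqr b y0 kk).1.
have [|||||||] := @fubini_dominated R (fun x b => g x * (f b * k (x - b))) f
  (fun x b => `|g x * k (x - b)|) (\int[mu]_x (g x ^+ 2) + pi / y).
- apply: measurable_funM; first exact: (measurableT_comp mg measurable_fst).
  apply: measurable_funM; last exact: measurable_sub2.
  exact: (measurableT_comp (L1_measurable fi) measurable_snd).
- exact: fi.
- by move=> b; exact: L1_norm.
- move=> b; have [k2 k2le] := cauchy_part_sqr b y0 kk.
  apply: (@le_trans _ _ (\int[mu]_x (g x ^+ 2 + k (x - b) ^+ 2))).
    apply: int_le; [exact: L1_norm|exact: L1D|move=> x].
    rewrite ler_norml.
    have := sqr_ge0 (g x + k (x - b)); have := sqr_ge0 (g x - k (x - b)).
    have := sqr_ge0 (g x); have := sqr_ge0 (k (x - b)).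
    by move=> *; apply/andP; split; nra.
  by rewrite intD// lerD2l.
- by move=> x b; rewrite !normrM mulrCA.
- by move=> x; apply: L1Z; exact: L1_conv kk fi.
- move=> b; have := L1Z (f b) (igk b); apply: eq_integrable => // x _ /=.
  by rewrite mulrCA.
have E x : \int[mu]_a (g x * (f a * k (x - a))) = g x * conv k f x.
  by rewrite intZ//; exact: L1_conv kk fi.
have E' b : \int[mu]_x (g x * (f b * k (x - b))) = f b * \int[mu]_x (g x * k (x - b)).
  by rewrite -intZ//; apply: eq_Rintegral => x _; rewrite mulrCA.
move=> i e; split; first by move: i; rewrite (funext E).
transitivity (\int[mu]_x \int[mu]_a (g x * (f a * k (x - a)))).
  by apply: eq_Rintegral => x _; rewrite E.
by rewrite e; apply: eq_Rintegral => b _; rewrite E'.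
Qed.

(** Fubini yields the measurability of [g * conv k f] for square integrable [g];
    a positive [g] can be divided out. *)
Lemma measurable_conv (y : R) k f : 0 < y -> cauchy_part y k -> L1 f ->
  measurable_fun setT (conv k f).
Proof.
move=> y0 kk fi.
have [||/L1_measurable m _] := @conv_fubini y f (poisson 1) k y0 kk fi.
- exact: measurable_poisson.
- have [h _] := @cauchy_part_sqr R 1 (poisson 1) 0 ltr01 (poisson_part _).
  by move: h; apply: eq_integrable => // x _ /=; rewrite subr0.
have -> : conv k f = (fun x => (x ^+ 2 + 1 ^+ 2) * (poisson 1 x * conv k f x)).
  apply/funext => x; rewrite /poisson mulrA mulrCA mulfV ?mulr1 ?mul1r// gt_eqF//.
  exact: quad_gt0.
apply: measurable_funM => //; apply: measurable_funD => //.
Qed.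

Lemma conv_bounded (y x : R) k f : 0 < y -> cauchy_part y k -> L1 f ->
  `|conv k f x| <= y^-1 * \int[mu]_b `|f b|.
Proof.
move=> y0 kk fi; rewrite -intZ; last exact: L1_norm.
apply: norm_int_le.
- exact: L1_measurable (L1_conv x y0 kk fi).
- by apply: L1Z; exact: L1_norm.
- move=> b; rewrite normrM mulrC ler_wpM2r//; exact: cauchy_part_bounded.
Qed.

(** Jensen's inequality for the measure [|f|], whose total mass is [m - 1]:
    the square of [conv k f] is dominated by a multiple of the convolution of
    [|f|] with [k^2].  Using [m] instead avoids a division by zero. *)
Lemma conv_sqr (y : R) k f : 0 < y -> cauchy_part y k -> L1 f ->
  L1 (fun x => conv k f x ^+ 2).
Proof.
move=> y0 kk fi.
have mk := measurable_cauchy_part y0 kk.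
have mc := measurable_conv y0 kk fi.
have k2i x : L1 (fun b => `|f b| * k (x - b) ^+ 2).
  apply: (@L1_mul_bounded _ _ _ (y^-1 ^+ 2)); first exact: L1_norm.
    by apply: measurable_funX; exact: measurable_rsub.
  move=> b; rewrite normrX ler_sqr ?nnegrE ?invr_ge0 ?(ltW y0)//.
  exact: cauchy_part_bounded.
have k1i x : L1 (fun b => `|f b| * `|k (x - b)|).
  apply: (@L1_mul_bounded _ _ _ (y^-1)); first exact: L1_norm.
    by apply: measurableT_comp => //; exact: measurable_rsub.
  by move=> b; rewrite normr_id; exact: cauchy_part_bounded.
have [||||||| i _] := @fubini_dominated R (fun x b => `|f b| * k (x - b) ^+ 2) f
  (fun x b => k (x - b) ^+ 2) (pi / y).
- apply: measurable_funM.
    apply: measurableT_comp => //.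
    exact: (measurableT_comp (L1_measurable fi) measurable_snd).
  by apply: measurable_funX; exact: measurable_sub2.
- exact: fi.
- by move=> b; exact: (cauchy_part_sqr b y0 kk).1.
- by move=> b; exact: (cauchy_part_sqr b y0 kk).2.
- by move=> x b; rewrite normrM normr_id ger0_norm ?sqr_ge0.
- exact: k2i.
- by move=> b; apply: L1Z; exact: (cauchy_part_sqr b y0 kk).1.
(* adding 1 keeps [m] positive when [f] vanishes almost everywhere *)
pose m := 1 + \int[mu]_b `|f b|.
have m0 : 0 < m by rewrite ltr_pwDl// int_ge0.
apply: (L1_le _ (L1Z m i)); first exact: measurable_funX.
move=> x; rewrite ger0_norm ?sqr_ge0//.
set u := \int[mu]_b (`|f b| * k (x - b) ^+ 2).
pose w := \int[mu]_b (`|f b| * `|k (x - b)|).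
have cw : `|conv k f x| <= w.
  apply: norm_int_le => //.
    exact: L1_measurable (L1_conv x y0 kk fi).
  by move=> b; rewrite normrM.
have w0 : 0 <= w by apply: int_ge0 => b; rewrite mulr_ge0.
(* the integral of [|f| (|k| - c)^2], optimised below with [c = w / m] *)
have cs c : 0 <= u + ((- 2 * c) * w + c ^+ 2 * \int[mu]_b `|f b|).
  have -> : u + ((- 2 * c) * w + c ^+ 2 * \int[mu]_b `|f b|) =
      \int[mu]_b (`|f b| * (`|k (x - b)| - c) ^+ 2).
    rewrite -!intZ//; last exact: L1_norm.
    rewrite -intD; [|exact: L1Z|by apply: L1Z; exact: L1_norm].
    rewrite -intD//; last by apply: L1D; [exact: L1Z|by apply: L1Z; exact: L1_norm].
    apply: eq_Rintegral => b _; rewrite -(real_normK (num_real (k (x - b)))); ring.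
  by apply: int_ge0 => b; rewrite mulr_ge0// sqr_ge0.
rewrite -(real_normK (num_real (conv k f x))).
apply: (@le_trans _ _ (w ^+ 2)); first by rewrite ler_sqr ?nnegrE.
have := cs (w / m).
have -> : \int[mu]_b `|f b| = m - 1 by rewrite /m addrAC subrr add0r.
have -> : u + (- 2 * (w / m) * w + (w / m) ^+ 2 * (m - 1)) =
   u - w ^+ 2 / m - (w / m) ^+ 2 by field; rewrite gt_eqF.
have := sqr_ge0 (w / m) => s0 h.
rewrite mulrC -ler_pdivrMr//; lra.
Qed.


(** The function [G] of the introduction; up to the factor [pi], the inner product
    of two conjugate Poisson integrals depends only on the sum of the two
    heights, through this function ([int_conv_conv]). *)
Definition poisson_energy f (y : R) : R := \int[mu]_b (f b * conv (poisson y) f b).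

Lemma cpoisson_shift_sqr y b : 0 < y ->
  measurable_fun setT (fun x : R => cpoisson y (x - b)) /\
  L1 (fun x => cpoisson y (x - b) ^+ 2).
Proof.
move=> y0; split; first by apply: measurable_subr; exact: measurable_cpoisson.
exact: (cauchy_part_sqr b y0 (cpoisson_part y)).1.
Qed.

Lemma int_cpoisson_conv f (y s b : R) : 0 < y -> 0 < s -> L1 f ->
  \int[mu]_x (cpoisson y (x - b) * conv (cpoisson s) f x) = pi * conv (poisson (s + y)) f b.
Proof.
move=> y0 s0 fi.
have [mq q2] := cpoisson_shift_sqr b y0.
have [_ ->] := conv_fubini s0 (cpoisson_part s) fi mq q2.
rewrite -intZ; last by apply: L1_conv (poisson_part _) fi; exact: addr_gt0.
apply: eq_Rintegral => c _; rewrite int_cpoisson_cpoisson// addrC mulrCA; congr (_ * _).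
by congr (_ * _); rewrite -poissonN opprB.
Qed.

Lemma int_conv_conv f (y s : R) : 0 < y -> 0 < s -> L1 f ->
  L1 (fun x => conv (cpoisson s) f x * conv (cpoisson y) f x) /\
  \int[mu]_x (conv (cpoisson s) f x * conv (cpoisson y) f x) = pi * poisson_energy f (s + y).
Proof.
move=> y0 s0 fi.
have mc := measurable_conv s0 (cpoisson_part s) fi.
have c2 := conv_sqr s0 (cpoisson_part s) fi.
have [i ->] := conv_fubini y0 (cpoisson_part y) fi mc c2; split=> //.
rewrite -intZ; last first.
  have sy0 := addr_gt0 s0 y0.
  apply: (L1_mul_bounded fi (measurable_conv sy0 (poisson_part _) fi)) => x.
  exact: conv_bounded sy0 (poisson_part _) fi.
apply: eq_Rintegral => b _; rewrite mulrCA; congr (_ * _).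
by rewrite -int_cpoisson_conv//; apply: eq_Rintegral => x _; rewrite mulrC.
Qed.

Lemma int_conv_sub_sqr f (y s : R) : 0 < y -> 0 < s -> L1 f ->
  L1 (fun x => (conv (cpoisson y) f x - conv (cpoisson s) f x) ^+ 2) /\
  \int[mu]_x ((conv (cpoisson y) f x - conv (cpoisson s) f x) ^+ 2) =
  pi * (poisson_energy f (y + y) - 2 * poisson_energy f (y + s) + poisson_energy f (s + s)).
Proof.
move=> y0 s0 fi.
have [iyy eyy] := int_conv_conv y0 y0 fi.
have [iys eys] := int_conv_conv s0 y0 fi.
have [iss ess] := int_conv_conv s0 s0 fi.
have E x : (conv (cpoisson y) f x - conv (cpoisson s) f x) ^+ 2 =
   conv (cpoisson y) f x * conv (cpoisson y) f x +
    ((- 2) * (conv (cpoisson y) f x * conv (cpoisson s) f x) +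
    conv (cpoisson s) f x * conv (cpoisson s) f x) by ring.
have i2 := L1D (L1Z (- 2) iys) iss.
rewrite (funext E); split; first exact: L1D.
rewrite (intD iyy i2) (intD (L1Z (- 2) iys) iss) (intZ (- 2) iys) eyy eys ess.
move: (poisson_energy f (y + y)) (poisson_energy f (y + s))
  (poisson_energy f (s + s)) => u v w; ring.
Qed.

(** [f b * f c <= (f b ^+ 2 + f c ^+ 2) / 2], and the kernel has mass [pi] in
    either variable. *)
Lemma poisson_energy_le f (y : R) : 0 < y -> L1 f -> L1 (fun x => f x ^+ 2) ->
  poisson_energy f y <= pi * \int[mu]_x (f x ^+ 2).
Proof.
move=> y0 fi f2.
have pf2 b : L1 (fun c => f c ^+ 2 * poisson y (b - c)) by exact: L1_conv (poisson_part y) f2.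
have pb b : L1 (fun c => poisson y (b - c)).
  have := L1_poisson b y0; apply: eq_integrable => // c _ /=.
  by rewrite -poissonN opprB.
have ipb b : \int[mu]_c poisson y (b - c) = pi.
  by rewrite -(int_poisson b y0); apply: eq_Rintegral => c _; rewrite -poissonN opprB.
have [||||||| i e] := @fubini_dominated R
  (fun b c => f c ^+ 2 * poisson y (b - c)) (fun x => f x ^+ 2)
  (fun b c => poisson y (b - c)) pi.
- apply: measurable_funM.
    exact: (measurableT_comp (L1_measurable f2) measurable_snd).
  by apply: measurable_sub2; exact: measurable_poisson.
- exact: f2.
- by move=> c; exact: L1_poisson.
- by move=> c; rewrite int_poisson.
- by move=> b c; rewrite normrM (ger0_norm (poisson_ge0 _ _)).
- exact: pf2.
- by move=> c; apply: L1Z; exact: L1_poisson.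
have {}e : \int[mu]_b \int[mu]_c (f c ^+ 2 * poisson y (b - c)) = pi * \int[mu]_x (f x ^+ 2).
  rewrite e -(intZ pi f2); apply: eq_Rintegral => c _.
  by rewrite (intZ (f c ^+ 2) (L1_poisson c y0)) (int_poisson c y0) mulrC.
have -> : pi * \int[mu]_x (f x ^+ 2) =
    \int[mu]_b (2^-1 * (pi * f b ^+ 2 + \int[mu]_c (f c ^+ 2 * poisson y (b - c)))).
  have i1 := L1Z pi f2.
  by rewrite (intZ 2^-1 (L1D i1 i)) (intD i1 i) (intZ pi f2) e; field.
apply: int_le.
- apply: (L1_mul_bounded fi (measurable_conv y0 (poisson_part _) fi)) => x.
  exact: conv_bounded y0 (poisson_part _) fi.
- by apply: L1Z; apply: L1D => //; exact: L1Z.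
- move=> b; have i1 := L1Z (f b ^+ 2) (pb b); have i2 := L1_conv b y0 (poisson_part y) fi.
  have -> : 2^-1 * (pi * f b ^+ 2 + \int[mu]_c (f c ^+ 2 * poisson y (b - c))) =
      \int[mu]_c (2^-1 * (f b ^+ 2 * poisson y (b - c) + f c ^+ 2 * poisson y (b - c))).
    rewrite (intZ 2^-1 (L1D i1 (pf2 b))) (intD i1 (pf2 b)).
    by rewrite (intZ (f b ^+ 2) (pb b)) ipb mulrC (mulrC pi) mulrC.
  rewrite /conv -(intZ (f b) i2).
  apply: int_le.
  + by apply: L1Z; exact: L1_conv (poisson_part y) fi.
  + by apply: L1Z; apply: L1D => //; exact: L1Z.
  + move=> c; have := poisson_ge0 (b - c) y0; have := sqr_ge0 (f b - f c) => h1 h2.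
    have := mulr_ge0 h1 h2; lra.
Qed.

(** If [G] increased by [d > 0] over a step [h], midpoint convexity would make
    it increase by at least [d] over every later step, hence be unbounded. *)
Lemma midconvex_bounded_decr (G : R -> R) (C : R) :
  (forall y s, 0 < y -> 0 < s -> 0 <= G (y + y) - 2 * G (y + s) + G (s + s)) ->
  (forall y, 0 < y -> G y <= C) ->
  forall x y, 0 < x -> x <= y -> G y <= G x.
Proof.
move=> cG GC x y x0 xy; rewrite leNgt; apply/negP => Gxy.
have h0 : 0 <= y - x by rewrite subr_ge0.
set h := y - x in h0; set d := G y - G x.
have d0 : 0 < d by rewrite subr_gt0.
have step n : d <= G (x + n.+1%:R * h) - G (x + n%:R * h).
  elim: n => [|n IH]; first by rewrite mul1r mul0r addr0 /d /h subrKC.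
  apply: (le_trans IH).
  have := cG ((x + n%:R * h) / 2) ((x + n.+2%:R * h) / 2).
  have n0 m : 0 < x + m%:R * h by rewrite ltr_wpDr// mulr_ge0.
  rewrite !divr_gt0// => /(_ isT isT).
  have -> : (x + n%:R * h) / 2 + (x + n%:R * h) / 2 = x + n%:R * h by field.
  have -> : (x + n.+2%:R * h) / 2 + (x + n.+2%:R * h) / 2 = x + n.+2%:R * h by field.
  have -> : (x + n%:R * h) / 2 + (x + n.+2%:R * h) / 2 = x + n.+1%:R * h.
    by rewrite -addn2 -addn1 !natrD; field.
  lra.
have grow n : G x + n%:R * d <= G (x + n%:R * h).
  elim: n => [|n IH]; first by rewrite !mul0r !addr0.
  have := step n; rewrite -natr1 mulrDl mul1r; lra.
have [n] : exists n : nat, (C - G x) / d < n%:R.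
  exists (Num.bound ((C - G x) / d)); apply: archi_boundP.
  by rewrite divr_ge0 ?(ltW d0)// subr_ge0; exact: GC.
rewrite ltr_pdivrMr// => h1.
have := grow n; have := GC (x + n%:R * h); rewrite ltr_wpDr ?mulr_ge0// => /(_ isT).
lra.
Qed.

(** The second difference that measures [|v_y - v_s|^2] involves values of the
    energy at heights below [2 d], all close to its supremum. *)
Lemma conv_L2_cauchy f (e : R) : L1 f -> L1 (fun x => f x ^+ 2) -> 0 < e ->
  exists2 d : R, 0 < d & forall y s, 0 < y <= d -> 0 < s <= d ->
    \int[mu]_x ((conv (cpoisson y) f x - conv (cpoisson s) f x) ^+ 2) <= e.
Proof.
move=> fi f2 e0; have [G GE] : exists G, poisson_energy f = G by exists (poisson_energy f).
pose C := pi * \int[mu]_x (f x ^+ 2).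
have GC y : 0 < y -> G y <= C by move=> y0; rewrite -GE; exact: poisson_energy_le.
have mG : forall x y, 0 < x -> x <= y -> G y <= G x.
  apply: (@midconvex_bounded_decr G C) => // y s y0 s0.
  rewrite -(pmulr_rge0 _ (pi_gt0 R)).
  have [_] := int_conv_sub_sqr y0 s0 fi; rewrite GE => <-.
  by apply: int_ge0 => x; exact: sqr_ge0.
pose E := [set G y | y in [set y : R | 0 < y]].
have hE : has_sup E.
  split; first by exists (G 1); exists 1 => //=.
  by exists C => _ [y y0 <-]; exact: GC.
have e1 : 0 < e / (2 * pi) by rewrite divr_gt0// mulr_gt0// pi_gt0.
have [_ [d /= d0 <-] dS] := sup_adherent e1 hE.
exists (d / 2); first by rewrite divr_gt0.
move=> y s /andP[y0 yd] /andP[s0 sd].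
have [_ ->] := int_conv_sub_sqr y0 s0 fi.
rewrite GE.
have up u : 0 < u -> G u <= sup E by move=> u0; apply: sup_upper_bound => //; exists u.
have := up _ (addr_gt0 y0 y0); have := up _ (addr_gt0 s0 s0).
have : G d <= G (y + s) by apply: mG; [exact: addr_gt0|lra].
move=> h1 h2 h3.
have : G (y + y) - 2 * G (y + s) + G (s + s) <= 2 * (e / (2 * pi)) by lra.
move=> h; apply: (le_trans (ler_wpM2l (ltW (pi_gt0 R)) h)).
have pi0 : (pi : R) != 0 by rewrite gt_eqF// pi_gt0.
rewrite le_eqVlt; apply/orP; left; apply/eqP.
by move: pi0; move: (pi : R) => p p0; field.
Qed.

End Conv.


(** * Completeness of weighted L^1, with almost everywhere convergence *)

Section Complete.
Context {R : realType}.
Local Notation mu := (@lebesgue_measure R).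
Implicit Types (f g k : R -> R).

(** The proof of completeness of L^1: the summable increments have an almost
    everywhere finite sum, which dominates the sequence.  The weight [w]
    turns convergence in L^2 into convergence in L^1, and the last clause is
    convergence against every kernel [k] controlled by the weight. *)
Lemma weighted_L1_complete (V : nat -> R -> R) (w : R -> R) (C : R) :
  (forall n, measurable_fun setT (V n)) -> measurable_fun setT w ->
  (forall t, 0 < w t) -> 0 <= C -> L1 (fun t => w t * `|V 0%N t|) ->
  (forall n, L1 (fun t => w t * `|V n.+1 t - V n t|)) ->
  (forall n, \int[mu]_t (w t * `|V n.+1 t - V n t|) <= C / (2 ^ n.+1)%:R) ->
  exists H : R -> R, [/\ measurable_fun setT H,
    {ae mu, forall t, V n t @[n --> \oo] --> H t} &
    forall (k : R -> R) (c : R), measurable_fun setT k ->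
      (forall t, `|k t| <= c * w t) ->
      L1 (fun t => k t * H t) /\
      \int[mu]_t (k t * V n t) @[n --> \oo] --> \int[mu]_t (k t * H t)].
Proof.
move=> mV mw w0 C0 iV0 id dC.
pose d n t := w t * `|V n.+1 t - V n t|.
have d0 n t : 0 <= d n t by rewrite mulr_ge0// ltW.
pose T t := (\sum_(0 <= n <oo) (d n t)%:E)%E.
have md n : measurable_fun setT (fun t => (d n t)%:E).
  by apply: (measurable_EFinP _ _).2; exact: L1_measurable (id n).
have mT : measurable_fun setT T.
  by apply: ge0_emeasurable_sum => // n t _ _; rewrite lee_fin.
have T0 t : (0 <= T t)%E by apply: nneseries_ge0 => n _; rewrite lee_fin.
have iT : mu.-integrable setT T.
  apply/integrableP; split=> //.
  under eq_integral do rewrite gee0_abs//.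
  apply: (@le_lt_trans _ _ C%:E); last exact: ltry.
  rewrite /T integral_nneseries//; last by move=> n t _; rewrite lee_fin.
  apply: le_trans (epsilon_trick0 xpredT C0).
  apply: lee_nneseries => [n _ _|n _]; first by apply: integral_ge0 => t _; rewrite lee_fin.
  by rewrite -(EFin_int (id n)) lee_fin.
have aeT : {ae mu, forall t, T t \is a fin_num}.
  have := integrable_ae measurableT iT.
  by apply: ae_mono => t; apply.
have VE n t : V n t = V 0%N t + \sum_(0 <= k < n) (V k.+1 t - V k t).
  by rewrite telescope_sumr// addrC subrK.
have sumT n t : T t \is a fin_num -> w t * \sum_(0 <= k < n) `|V k.+1 t - V k t| <= fine (T t).
  move=> Tt; rewrite -lee_fin fineK// mulr_sumr.
  have h : (\sum_(0 <= k < n) (d k t)%:E <= T t)%E.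
    by apply: nneseries_lim_ge => k _ _; rewrite lee_fin.
  rewrite sumEFin in h; exact: h.
have VT n t : T t \is a fin_num -> w t * `|V n t| <= w t * `|V 0%N t| + fine (T t).
  move=> Tt; apply: le_trans (lerD (lexx _) (sumT n t Tt)).
  rewrite -mulrDr ler_pM2l// VE (le_trans (ler_normD _ _))// lerD2l.
  exact: ler_norm_sum.
(* a limit superior is measurable without any convergence *)
pose H t := fine (limn_esup (fun n => (V n t)%:E)).
have aeH : {ae mu, forall t, V n t @[n --> \oo] --> H t}.
  apply: ae_mono aeT => t Tt.
  have cV : cvgn (fun n => V n t).
    have cS : cvgn (series (fun j : nat => V j.+1 t - V j t)).
      apply: normed_cvg; apply: nondecreasing_is_cvgn.
        by apply: nondecreasing_series => n _ _; exact: normr_ge0.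
      exists ((w t)^-1 * fine (T t)) => _ [n _ <-].
      by rewrite ler_pdivlMl//; exact: sumT.
    have -> : (fun n => V n t) = (fun n => V 0%N t + series (fun j : nat => V j.+1 t - V j t) n).
      by apply/funext => n; rewrite VE.
    by apply: is_cvgD => //; exact: is_cvg_cst.
  have cE : (V n t)%:E @[n --> \oo] --> (limn (fun n => V n t))%:E.
    by apply: (cvg_EFin (f := fun n => (V n t)%:E)); [exact: nearW|exact: cV].
  by rewrite /H (cvg_limn_einf_sup cE).2.
have mH : measurable_fun setT H.
  apply: measurableT_comp => //.
  apply: (@measurable_fun_limn_esup _ _ _ _ (fun n t => (V n t)%:E)) => n.
  exact: (measurable_EFinP _ _).2.
exists H; split=> // k c mk kw.
have ifT : L1 (fine \o T).
  apply: le_integrable iT => //.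
    by apply: (measurable_EFinP _ _).2; exact: measurableT_comp.
  move=> t _ /=; rewrite (gee0_abs (T0 t)) ger0_norm ?fine_ge0//.
  by have := T0 t; case: (T t).
apply: (@dominated_cvg_int_ae _ (fun n t => k t * V n t) (fun t => k t * H t)
  (fun t => c * (w t * `|V 0%N t| + fine (T t)))).
- by move=> n; exact: measurable_funM.
- exact: measurable_funM.
- by apply: ae_mono aeH => t Ht; apply: cvgMr.
- by apply: L1Z; apply: L1D.
- apply: ae_mono aeT => t Tt n; rewrite normrM.
  have c0 : 0 <= c.
    by rewrite -(pmulr_lge0 _ (w0 t)); exact: le_trans (kw t).
  apply: (@le_trans _ _ (c * (w t * `|V n t|))).
    by rewrite mulrA ler_wpM2r.
  by rewrite ler_wpM2l// VT.
Qed.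

End Complete.


(** * The boundary value of the conjugate Poisson integral *)

Section Boundary.
Context {R : realType}.
Local Notation mu := (@lebesgue_measure R).
Implicit Types (f g k : R -> R).

(** All Poisson kernels are controlled by the weight [poisson 1]; the constant
    comes from [1 + t^2 <= 1 + 2 x^2 + 2 (x - t)^2]. *)
Lemma poisson_le_poisson1 (s x t : R) : 0 < s ->
  poisson s (x - t) <= (s * (2 + (1 + 2 * x ^+ 2) / s ^+ 2)) * poisson 1 t.
Proof.
move=> s0; rewrite /poisson -[leRHS]mulrA ler_pM2l// mul1r expr1n.
have q1 : 0 < t ^+ 2 + 1 by rewrite ltr_wpDl ?sqr_ge0.
have q2 := quad_gt0 (x - t) s0.
rewrite ler_pdivlMr// mulrC ler_pdivrMr// mulrDl.
have h : (1 + 2 * x ^+ 2) <= (1 + 2 * x ^+ 2) / s ^+ 2 * ((x - t) ^+ 2 + s ^+ 2).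
  rewrite mulrDr divfK ?gt_eqF ?exprn_gt0// lerDr.
  by rewrite mulr_ge0 ?sqr_ge0// divr_ge0 ?sqr_ge0// addr_ge0// mulr_ge0// sqr_ge0.
have := sqr_ge0 (x - 2^-1 * t); have := sqr_ge0 s; have := sqr_ge0 (2 * x - t). nra.
Qed.

Lemma conv_cvg_sub f (y : nat -> R) (s x : R) : L1 f -> 0 < s ->
  (forall n, 0 < y n) -> y n @[n --> \oo] --> 0 ->
  conv (cpoisson (s + y n)) f x @[n --> \oo] --> conv (cpoisson s) f x.
Proof.
move=> fi s0 y0 yc.
have qs n : 0 < s + y n by exact: addr_gt0.
apply: (@dominated_cvg_int _ (fun n b => f b * cpoisson (s + y n) (x - b))
  (fun b => f b * cpoisson s (x - b)) (fun b => s^-1 * `|f b|)).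
- by move=> n; exact: L1_measurable (L1_conv x (qs n) (cpoisson_part _) fi).
- exact: L1_measurable (L1_conv x s0 (cpoisson_part _) fi).
- move=> b; apply: cvgMr; apply: cvgMr; apply: cvgV; first by rewrite gt_eqF// quad_gt0.
  apply: cvgD; first exact: cvg_cst.
  apply: (@cvg_comp _ _ _ (fun n => s + y n) (fun u => u ^+ 2)); last exact: exprn_continuous.
  have : s + y n @[n --> \oo] --> s + 0 by apply: cvgD => //; exact: cvg_cst.
  by rewrite addr0.
- by apply: L1Z; exact: L1_norm.
- move=> n b; rewrite normrM mulrC ler_wpM2r//.
  apply: (le_trans (cauchy_part_bounded (x - b) (qs n) (cpoisson_part _))).
  by rewrite lef_pV2 ?posrE// lerDl ltW.
Qed.

(** Heights along which the increments are summable, as completeness requires. *)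
Lemma cauchy_sequence f : L1 f -> L1 (fun x => f x ^+ 2) ->
  exists y : nat -> R, [/\ forall n, 0 < y n, y n @[n --> \oo] --> 0 &
    forall n, \int[mu]_x ((conv (cpoisson (y n.+1)) f x - conv (cpoisson (y n)) f x) ^+ 2)
      <= ((2 ^ n)%:R^-1) ^+ 2].
Proof.
move=> fi f2.
have /choice[d dP] : forall n : nat, exists d : R, 0 < d /\
   forall y s, 0 < y <= d -> 0 < s <= d ->
    \int[mu]_x ((conv (cpoisson y) f x - conv (cpoisson s) f x) ^+ 2) <= ((2 ^ n)%:R^-1) ^+ 2.
  move=> n; have [|d d0 h] := conv_L2_cauchy (e := ((2 ^ n)%:R^-1) ^+ 2) fi f2.
    by rewrite exprn_gt0// invr_gt0 ltr0n expn_gt0.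
  by exists d.
(* running minima make the heights nonincreasing, so that two consecutive
   ones are both below [d n]; the bound by [1 / (n + 1)] sends them to 0 *)
pose d' n := Num.min (d n) n.+1%:R^-1.
have d'0 n : 0 < d' n by rewrite lt_min (dP n).1 invr_gt0 ltr0n.
pose y := fix y n := if n is m.+1 then Num.min (y m) (d' n) else d' 0%N.
have yS n : y n.+1 = Num.min (y n) (d' n.+1) by [].
have y0 n : 0 < y n.
  by elim: n => [|n IH]; [exact: d'0|rewrite yS lt_min IH d'0].
have yd' n : y n <= d' n by case: n => [|n]; [exact: lexx|rewrite yS ge_min lexx orbT].
have ydec n : y n.+1 <= y n by rewrite yS ge_min lexx.
have yd n : y n <= d n by rewrite (le_trans (yd' n))// /d' ge_min lexx.
exists y; split=> //.
- apply: (@squeeze_cvgr _ _ _ _ (fun=> 0) (@harmonic R)).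
  + apply: nearW => n; rewrite ltW//= (le_trans (yd' n))//.
    by rewrite /d' /harmonic/= ge_min lexx orbT.
  + exact: cvg_cst.
  + exact: cvg_harmonic.
- move=> n; apply: (dP n).2; rewrite y0/= ?yd//.
  exact: le_trans (ydec n) (yd n).
Qed.

(** [H] is the limit of conjugate Poisson integrals at heights [y n] tending
    to 0; integrated against [poisson s] they give the one at height
    [s + y n], which tends to the one at height [s]. *)
Lemma conj_boundary_value f : L1 f -> L1 (fun x => f x ^+ 2) ->
  exists2 H : R -> R, measurable_fun setT H & forall s x, 0 < s ->
    L1 (fun t => poisson s (x - t) * H t) /\
    \int[mu]_t (poisson s (x - t) * H t) = pi * conv (cpoisson s) f x.
Proof.
move=> fi f2; have [y [y0 yc ysq]] := cauchy_sequence fi f2.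
pose V n := conv (cpoisson (y n)) f.
have mV n : measurable_fun setT (V n) by exact: measurable_conv (y0 n) (cpoisson_part _) fi.
have w2 : L1 (fun t => poisson (1:R) t ^+ 2) /\ \int[mu]_t (poisson 1 t ^+ 2) <= pi.
  have [h1 h2] := @cauchy_part_sqr R 1 (poisson 1) 0 ltr01 (poisson_part _).
  rewrite divr1 in h2; split.
    by move: h1; apply: eq_integrable => // t _ /=; rewrite subr0.
  move: h2; by under eq_Rintegral do rewrite subr0.
have mp1 : measurable_fun setT (poisson (1:R)) by exact: measurable_poisson.
have w0 t : 0 < poisson (1:R) t by rewrite divr_gt0// quad_gt0.
have iwd n : L1 (fun t => poisson 1 t * `|V n.+1 t - V n t|).
  apply: L1_mul_sqr => //.
  + by apply: measurableT_comp => //; exact: measurable_funB.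
  + exact: w2.1.
  + have [h _] := int_conv_sub_sqr (y0 n.+1) (y0 n) fi.
    by move: h; apply: eq_integrable => // t _ /=; rewrite real_normK// num_real.
have [||||H [mH aeH HP]] := @weighted_L1_complete R V (poisson 1) (pi + 1) mV mp1 w0.
- by rewrite addr_ge0// ltW// pi_gt0.
- apply: L1_mul_sqr => //.
  + exact: measurableT_comp.
  + exact: w2.1.
  + have := conv_sqr (y0 0%N) (cpoisson_part _) fi.
    by apply: eq_integrable => // t _ /=; rewrite real_normK// num_real.
- exact: iwd.
- move=> n; have [h _] := int_conv_sub_sqr (y0 n.+1) (y0 n) fi.
  set a := ((2 ^ n)%:R^-1 : R).
  have a0 : 0 < a by rewrite invr_gt0 ltr0n expn_gt0.
  have i1 := L1Z a w2.1; have i2 := L1Z a^-1 h.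
  (* [u v <= (a v^2 + u^2 / a) / 2]: both terms are then of order [2^-n] *)
  apply: (@le_trans _ _ (\int[mu]_t (2^-1 * (a * poisson 1 t ^+ 2 +
      a^-1 * (V n.+1 t - V n t) ^+ 2)))).
    apply: int_le.
    + exact: iwd.
    + exact: L1Z (L1D i1 i2).
    + move=> t; rewrite -(real_normK (num_real (V n.+1 t - V n t))).
      move: (`|_|) (poisson 1 t) => u v.
      have := sqr_ge0 (a * v - u) => hs.
      rewrite -(ler_pM2l a0).
      have -> : a * (2^-1 * (a * v ^+ 2 + a^-1 * u ^+ 2)) = 2^-1 * ((a * v) ^+ 2 + u ^+ 2).
        by move: (a) a0 => c c0; field; rewrite gt_eqF.
      by move: hs; rewrite mulrA; move: (a * v) => z; nra.
  rewrite (intZ 2^-1 (L1D i1 i2)) (intD i1 i2) (intZ a w2.1) (intZ a^-1 h).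
  have := ysq n; rewrite -/a; have := w2.2.
  move: (\int[mu]_x _) (\int[mu]_x _) => u v hv hu.
  have -> : (pi + 1) / (2 ^ n.+1)%:R = 2^-1 * (a * pi + a^-1 * a ^+ 2).
    rewrite expnS natrM -/a invfM -/a; move: (pi : R) => p.
    by field; rewrite gt_eqF.
  by rewrite ler_pM2l// lerD// ler_pM2l// invr_gt0.
exists H => // s x s0.
have [|| iH cH] := HP (fun t => poisson s (x - t)) (s * (2 + (1 + 2 * x ^+ 2) / s ^+ 2)).
- by apply: measurable_rsub; exact: measurable_poisson.
- by move=> t; rewrite ger0_norm ?poisson_ge0//; exact: poisson_le_poisson1.
split=> //.
have c2 : pi * conv (cpoisson (s + y n)) f x @[n --> \oo] --> pi * conv (cpoisson s) f x.
  by apply: cvgMr; exact: conv_cvg_sub.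
suff c3 : \int[mu]_t (poisson s (x - t) * V n t) @[n --> \oo] --> pi * conv (cpoisson s) f x.
  exact: (cvg_unique _ cH c3).
apply: cvg_trans c2; apply: near_eq_cvg; near=> n.
have yns : s != y n.
  rewrite gt_eqF//; near: n.
  by apply: (cvgr_lt _ yc).
have mk : measurable_fun setT (fun t : R => poisson s (x - t)).
  by apply: measurable_rsub; exact: measurable_poisson.
have k2 : L1 (fun t : R => poisson s (x - t) ^+ 2).
  have [h _] := @cauchy_part_sqr R s (poisson s) x s0 (poisson_part _).
  by move: h; apply: eq_integrable => // t _ /=; rewrite -poissonN opprB.
have [_ ->] := conv_fubini (y0 n) (cpoisson_part _) fi mk k2.
rewrite -intZ; last by apply: L1_conv (cpoisson_part _) fi; exact: addr_gt0.
by apply: eq_Rintegral => b _; rewrite int_poisson_cpoisson// mulrCA.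
Unshelve. all: by end_near. Qed.

End Boundary.


(** * Behaviour of truncated and Poisson integrals at Lebesgue points *)

Section LebesguePoint.
Context {R : realType}.
Local Notation mu := (@lebesgue_measure R).
Implicit Types (f g h : R -> R).

Lemma patch_ballE h (x r t : R) :
  (h \_ (ball x r)) t = if `|t - x| < r then h t else 0.
Proof.
rewrite patchE; have -> // : (t \in (ball x r : set R)) = (`|t - x| < r).
by apply/idP/idP; rewrite inE /ball/= distrC.
Qed.

Section Estimate.
Context (h : R -> R) (x : R) (mh : measurable_fun setT h).
Context (h0 : forall t, 0 <= h t) (ih : L1 (fun t => poisson 1 (t - x) * h t)).

Lemma L1_patch_ball r : L1 (h \_ (ball x r)).
Proof.
apply: (L1_le _ (L1Z (1 + r ^+ 2) ih)).
  by apply: measurable_patch => //; exact: measurable_ball.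
move=> t; rewrite patch_ballE; case: ifPn => tr; last first.
  by rewrite normr0 mulr_ge0 ?addr_ge0 ?sqr_ge0// mulr_ge0// poisson_ge0.
rewrite ger0_norm// mulrA ler_peMl//.
rewrite /poisson mulrA mulr1 ler_pdivlMr ?quad_gt0// mul1r expr1n addrC lerD2l.
rewrite -(real_normK (num_real (t - x))); have := normr_ge0 (t - x); nra.
Qed.

Lemma L1_poisson_patch_ball e r : 0 < e -> L1 (fun t => poisson e (t - x) * (h \_ (ball x r)) t).
Proof.
move=> e0.
have mp : measurable_fun setT (fun t : R => poisson e (t - x)).
  by apply: measurable_subr; exact: measurable_poisson.
have pe t : `|poisson e (t - x)| <= e^-1 by exact: cauchy_part_bounded (poisson_part _).
have := L1_mul_bounded (L1_patch_ball r) mp pe.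
by apply: eq_integrable => // t _; rewrite /= mulrC.
Qed.

(** On the annulus [2^k e <= |t - x| < 2^(k+1) e] the kernel is at most
    [1 / (4^k e)] and the integral of [h] at most [2 * 2^(k+1) e eta], so the
    annulus adds at most [4 eta / 2^k]: exactly the increment of the bound from
    [k] to [k + 1]. *)
Lemma dyadic_estimate (eta delta e : R) (k : nat) :
  (forall r, 0 < r < delta -> \int[mu]_t (h \_ (ball x r)) t <= 2 * r * eta) ->
  0 < e -> 2 ^+ k * e < delta ->
  \int[mu]_t (poisson e (t - x) * (h \_ (ball x (2 ^+ k * e))) t) <= (10 - 8 / 2 ^+ k) * eta.
Proof.
move=> avg e0.
elim: k => [|k IH] kd.
  rewrite expr0 mul1r in kd *; rewrite divr1.
  apply: (@le_trans _ _ (e^-1 * (2 * e * eta))).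
    apply: (@le_trans _ _ (\int[mu]_t (e^-1 * (h \_ (ball x e)) t))).
      apply: int_le; [exact: L1_poisson_patch_ball|by apply: L1Z; exact: L1_patch_ball|move=> t].
      rewrite ler_wpM2r//.
        by rewrite patch_ballE; case: ifP.
      by apply: le_trans (cauchy_part_bounded (t - x) e0 (poisson_part _)); exact: ler_norm.
    rewrite (intZ e^-1 (L1_patch_ball e)) ler_wpM2l ?invr_ge0 ?(ltW e0)//.
    by apply: avg; rewrite e0.
  by rewrite le_eqVlt; apply/orP; left; apply/eqP; field; rewrite gt_eqF.
set c : R := 2 ^+ k in IH *.
have c0 : 0 < c by rewrite exprn_gt0.
have kd2 : 2 * c * e < delta by rewrite -exprS.
have ck : c * e < delta by apply: le_lt_trans kd2; rewrite ler_pM2r// ler_peMl ?(ltW c0)// ler1n.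
rewrite exprS -/c.
have i1 := L1_poisson_patch_ball (c * e) e0.
have i2 := L1Z (c ^+ 2 * e)^-1 (L1_patch_ball (2 * c * e)).
apply: (@le_trans _ _ ((10 - 8 / c) * eta + (c ^+ 2 * e)^-1 * (2 * (2 * c * e) * eta))); last first.
  by rewrite le_eqVlt; apply/orP; left; apply/eqP; field; rewrite !gt_eqF.
apply: (@le_trans _ _ (\int[mu]_t (poisson e (t - x) * (h \_ (ball x (c * e))) t +
    (c ^+ 2 * e)^-1 * (h \_ (ball x (2 * c * e))) t))).
  apply: int_le; [exact: L1_poisson_patch_ball|exact: L1D|move=> t].
  have V0 : 0 <= (c ^+ 2 * e)^-1 by rewrite invr_ge0 mulr_ge0 ?sqr_ge0// ltW.
  have p0 := poisson_ge0 (t - x) e0.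
  rewrite !patch_ballE; have [t1|t1] := ltP `|t - x| (c * e).
    have -> : `|t - x| < 2 * c * e.
      by apply: (lt_le_trans t1); rewrite ler_pM2r// ler_peMl ?(ltW c0)// ler1n.
    by rewrite lerDl mulr_ge0.
  case: ifP => _; last by rewrite !mulr0 addr0.
  rewrite mulr0 add0r ler_wpM2r// /poisson.
  rewrite ler_pdivrMr ?quad_gt0// ler_pdivlMl ?mulr_gt0 ?exprn_gt0//.
  rewrite -(real_normK (num_real (t - x))).
  have ce0 : 0 <= c * e by rewrite mulr_ge0// ltW.
  have : (c * e) ^+ 2 <= `|t - x| ^+ 2 by rewrite ler_sqr ?nnegrE.
  have -> : c ^+ 2 * e * e = (c * e) ^+ 2 by ring.
  by have := sqr_ge0 e; lra.
rewrite (intD i1 i2) (intZ (c ^+ 2 * e)^-1 (L1_patch_ball (2 * c * e))).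
apply: lerD; first exact: IH.
rewrite ler_wpM2l ?invr_ge0 ?mulr_ge0 ?sqr_ge0 ?(ltW e0) ?(ltW c0)//.
by apply: avg; rewrite kd2 !mulr_gt0.
Qed.

(** The dyadic estimate covers a ball of radius at least [delta / 2]; outside
    it, [poisson e] is [O(e)] times [poisson 1]. *)
Lemma poisson_average_le (eta delta e : R) :
  (forall r, 0 < r < delta -> \int[mu]_t (h \_ (ball x r)) t <= 2 * r * eta) ->
  0 < e < delta -> 0 <= eta ->
  L1 (fun t => poisson e (t - x) * h t) /\
  \int[mu]_t (poisson e (t - x) * h t) <= 10 * eta +
    e * (1 + 4 / delta ^+ 2) * \int[mu]_t (poisson 1 (t - x) * h t).
Proof.
move=> avg /andP[e0 ed] eta0.
have d0 : 0 < delta by exact: lt_trans ed.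
have [k kd dk] : exists2 k : nat, 2 ^+ k * e < delta & delta <= 2 * (2 ^+ k * e).
  pose P (k : nat) := delta <= 2 * (2 ^+ k * e).
  have exP : exists k, P k.
    exists (Num.bound (delta / e)); rewrite /P.
    have := archi_boundP (divr_ge0 (ltW d0) (ltW e0)).
    rewrite ltr_pdivrMr// => /ltW/le_trans; apply.
    rewrite mulrA ler_pM2r//.
    apply: (@le_trans _ _ (2 ^+ Num.bound (delta / e))); last first.
      by rewrite ler_peMl ?exprn_ge0// ler1n.
    by rewrite -natrX ler_nat ltnW// ltn_expl.
  case: (ex_minnP exP) => -[|k] Pk mink.
    by exists 0%N => //; rewrite expr0 mul1r.
  exists k.+1 => //; rewrite ltNge; apply/negP => h1.
  have := mink k; rewrite /P mulrA -exprS => /(_ h1); by rewrite ltnn.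
set r := 2 ^+ k * e in kd dk.
have r0 : 0 < r by rewrite mulr_gt0// exprn_gt0.
have i1 := L1_poisson_patch_ball r e0.
have i2 := L1Z (e * (1 + 4 / delta ^+ 2)) ih.
have c0 : 0 <= e * (1 + 4 / delta ^+ 2).
  by rewrite mulr_ge0 ?(ltW e0)// addr_ge0// divr_ge0// sqr_ge0.
have pw t : poisson e (t - x) * h t <= poisson e (t - x) * (h \_ (ball x r)) t +
    e * (1 + 4 / delta ^+ 2) * (poisson 1 (t - x) * h t).
  rewrite patch_ballE; case: ifPn => tr.
    by rewrite lerDl mulr_ge0// mulr_ge0// poisson_ge0.
  rewrite mulr0 add0r mulrA ler_wpM2r// /poisson expr1n mulrA mulr1.
  rewrite -leNgt in tr.
  have u0 : 0 < (t - x) ^+ 2 + 1 by rewrite ltr_wpDl ?sqr_ge0.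
  rewrite ler_pdivlMr// mulrAC ler_pdivrMr ?quad_gt0// -mulrA ler_pM2l//.
  have : (delta / 2) ^+ 2 <= (t - x) ^+ 2.
    rewrite -(real_normK (num_real (t - x))) ler_sqr ?nnegrE ?divr_ge0 ?(ltW d0)//.
    by apply: le_trans tr; rewrite ler_pdivrMr// mulrC.
  have -> : (delta / 2) ^+ 2 = delta ^+ 2 / 4 by field.
  rewrite ler_pdivrMr// mulrC => h1.
  have : 1 <= 4 / delta ^+ 2 * (t - x) ^+ 2.
    by rewrite mulrAC ler_pdivlMr ?exprn_gt0// mul1r.
  have : 0 <= 4 / delta ^+ 2 by rewrite divr_ge0 ?sqr_ge0.
  move: (4 / delta ^+ 2) ((t - x) ^+ 2) (sqr_ge0 e) (sqr_ge0 (t - x)) => q w; nra.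
have mp : measurable_fun setT (fun t : R => poisson e (t - x)).
  by apply: measurable_subr; exact: measurable_poisson.
have ie : L1 (fun t => poisson e (t - x) * h t).
  apply: (L1_le _ (L1D i1 i2)); first exact: measurable_funM.
  by move=> t; rewrite ger0_norm; [exact: pw|by rewrite mulr_ge0// poisson_ge0].
split=> //.
apply: (@le_trans _ _ _ _ _ (int_le ie (L1D i1 i2) pw)).
rewrite (intD i1 i2) (intZ _ ih) lerD2r.
apply: (le_trans (dyadic_estimate avg e0 kd)).
by rewrite ler_wpM2r// gerBl divr_ge0// exprn_ge0.
Qed.

End Estimate.


Lemma lebesgue_pt_avg f (x : R) : measurable_fun setT f ->
  L1 (fun t => poisson 1 (t - x) * `|f t - f x|) -> lebesgue_pt f x ->
  forall eta, 0 < eta -> exists2 delta : R, 0 < delta & forall r, 0 < r < delta ->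
    \int[mu]_t ((fun t => `|f t - f x|) \_ (ball x r)) t <= 2 * r * eta.
Proof.
move=> mf ih fx eta eta0.
pose h t := `|f t - f x|.
have mh : measurable_fun setT h.
  by apply: measurableT_comp => //; exact: measurable_funB.
have h0 t : 0 <= h t by exact: normr_ge0.
have dE r : 0 < r -> davg f x r = ((r *+ 2)^-1 * \int[mu]_t (h \_ (ball x r)) t)%:E.
  move=> r0; rewrite /davg /iavg lebesgue_measure_ball ?(ltW r0)//.
  rewrite inver mulrn_eq0/= gt_eqF// EFinM; congr (_ * _)%E.
  rewrite EFin_int; last exact: L1_patch_ball.
  rewrite integral_mkcond; apply: eq_integral => t _.
  by rewrite !patchE; case: ifP.
have /fine_cvgP[_ fc] : davg f x r @[r --> 0^'+] --> (0%R)%:E by exact: fx.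
have := cvgr_lt _ fc _ eta0.
case=> d /= d0 dP; exists d => // r /andP[r0 rd].
have := dP r; rewrite /= sub0r normrN gtr0_norm// => /(_ rd r0).
by rewrite dE//= mulrC ltr_pdivrMr ?pmulrn_lgt0// => /ltW; rewrite mulrC mulr_natl.
Qed.

(** With averages at most [eta / 20], the dyadic part is at most [eta / 2]; the
    rest is [O(e)]. *)
Lemma poisson_oscillation_small f (x : R) : measurable_fun setT f ->
  L1 (fun t => poisson 1 (t - x) * `|f t - f x|) -> lebesgue_pt f x ->
  forall eta, 0 < eta -> \forall e \near 0^'+,
    L1 (fun t => poisson e (t - x) * `|f t - f x|) /\
    \int[mu]_t (poisson e (t - x) * `|f t - f x|) <= eta.
Proof.
move=> mf ih fx eta eta0.
have mh : measurable_fun setT (fun t => `|f t - f x|).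
  by apply: measurableT_comp => //; exact: measurable_funB.
have eta1 : 0 < eta / 20 by rewrite divr_gt0.
have [d d0 avg] := lebesgue_pt_avg mf ih fx eta1.
set A := \int[mu]_t (poisson 1 (t - x) * `|f t - f x|).
have A0 : 0 <= A by apply: int_ge0 => t; rewrite mulr_ge0// poisson_ge0.
pose c := (1 + 4 / d ^+ 2) * A.
have c0 : 0 <= c by rewrite mulr_ge0// addr_ge0// divr_ge0// sqr_ge0.
near=> e.
have e0 : 0 < e by near: e; exact: nbhs_right_gt.
have ed : e < d by near: e; exact: nbhs_right_lt.
have ec : e < (eta / 2) / (c + 1).
  by near: e; apply: nbhs_right_lt; rewrite !divr_gt0// ltr_wpDl.
have ed' : 0 < e < d by rewrite e0.
have [i le] := poisson_average_le mh (fun t => normr_ge0 _) ih avg ed' (ltW eta1).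
split=> //; apply: (le_trans le).
rewrite -mulrA -/A -/c.
move: ec; rewrite ltr_pdivlMr ?ltr_wpDl// => ec.
have -> : 10 * (eta / 20) = eta / 2 by field.
rewrite [leRHS](_ : eta = eta / 2 + eta / 2); last by field.
by rewrite lerD2l (le_trans _ (ltW ec))// ler_pM2l// lerDl.
Unshelve. all: by end_near. Qed.

(** The kernel of the truncated Hilbert transform, without the factor [1 / pi]. *)
Definition trunc_inv (e u : R) : R := if e < `|u| then u^-1 else 0.

(** Inversion is the pointwise limit of [cpoisson y] as [y] tends to 0, also
    at 0 where both sides are 0. *)
Lemma measurable_trunc_inv e : measurable_fun setT (trunc_inv e).
Proof.
have mi : measurable_fun setT (fun u : R => u^-1).
  have yn0 n : 0 < @harmonic R n by rewrite invr_gt0 ltr0n.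
  apply: (@measurable_fun_cvg _ _ _ _ (fun n => cpoisson (@harmonic R n))) => //.
    by move=> n; exact: measurable_cpoisson.
  move=> u _; have [->|u0] := eqVneq u 0.
    by rewrite invr0; apply: cvg_near_cst; apply: nearW => n; rewrite /cpoisson mul0r.
  have -> : u^-1 = u * (u ^+ 2 + 0 ^+ 2)^-1 by rewrite expr0n addr0; field.
  apply: cvgMr; apply: cvgV; first by rewrite expr0n addr0 sqrf_eq0.
  apply: cvgD; first exact: cvg_cst.
  apply: (@cvg_comp _ _ _ (@harmonic R) (fun u => u ^+ 2)); last exact: exprn_continuous.
  exact: cvg_harmonic.
rewrite /trunc_inv; apply: measurable_fun_ifT => //.
by apply: measurable_fun_ltr => //; exact: measurableT_comp.
Qed.

Lemma trunc_inv_sub_cpoisson e u : 0 < e -> `|trunc_inv e u - cpoisson e u| <= poisson e u.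
Proof.
move=> e0; have q := quad_gt0 u e0; rewrite /trunc_inv; case: ifPn => eu.
  have u0 : 0 < `|u| by exact: lt_trans eu.
  have u0' : u != 0 by rewrite -normr_gt0.
  have -> : u^-1 - cpoisson e u = e ^+ 2 / (u * (u ^+ 2 + e ^+ 2)).
    by rewrite /cpoisson; field; rewrite u0' gt_eqF.
  rewrite normrM normfV (ger0_norm (sqr_ge0 e)) (normrM u) (gtr0_norm q) /poisson.
  rewrite invfM mulrA ler_pM2r ?invr_gt0// ler_pdivrMr// expr2 ler_pM2l//.
  exact: ltW.
rewrite sub0r normrN /cpoisson normrM normfV (gtr0_norm q) ler_pM2r ?invr_gt0//.
by rewrite leNgt.
Qed.

Lemma trunc_invN e u : trunc_inv e (- u) = - trunc_inv e u.
Proof. by rewrite /trunc_inv normrN invrN; case: ifP => // _; rewrite oppr0. Qed.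

Definition truncated_pv f (x e : R) : R := \int[mu]_(t in [set t | e < `|x - t|]) (f t / (x - t)).

(** The difference of the two kernels is odd around [x], hence of integral 0, so
    [f] may be replaced by [f - f x]; it is bounded by the Poisson kernel. *)
Lemma truncated_pv_lebesgue_pt f (x : R) : L1 f -> lebesgue_pt f x ->
  truncated_pv f x e - conv (cpoisson e) f x @[e --> 0^'+] --> 0.
Proof.
move=> fi fx.
have mf := L1_measurable fi.
have ip1 : L1 (fun t => poisson 1 (t - x) * `|f t - f x|).
  apply: (@L1_le _ _ (fun t => `|f t| + `|f x| * poisson 1 (t - x))).
  - apply: measurable_funM; first by apply: measurable_subr; exact: measurable_poisson.
    by apply: measurableT_comp => //; exact: measurable_funB.
  - by apply: L1D; [exact: L1_norm|apply: L1Z; exact: L1_poisson].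
  - move=> t; have p0 := poisson_ge0 (t - x) (ltr01 : 0 < (1:R)).
    have p1 : poisson 1 (t - x) <= 1.
      have := cauchy_part_bounded (t - x) (ltr01 : 0 < (1:R)) (poisson_part _).
      by rewrite invr1; apply: le_trans; exact: ler_norm.
    rewrite normrM normr_id (ger0_norm p0).
    have := ler_normB (f t) (f x); have := normr_ge0 (f t); have := normr_ge0 (f x).
    move: `|f t - f x| `|f t| `|f x| => a b c; nra.
apply/cvgrPdist_le => /= eta eta0.
have := poisson_oscillation_small mf ip1 fx eta0; apply: filter_app; near=> e.
move=> [ie le].
have e0 : 0 < e by near: e; exact: nbhs_right_gt.
rewrite sub0r normrN.
pose kap t := trunc_inv e (x - t) - cpoisson e (x - t).
have mkap : measurable_fun setT kap.
  apply: measurable_funB; apply: measurable_rsub; first exact: measurable_trunc_inv.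
  exact: measurable_cpoisson.
have kp t : `|kap t| <= poisson e (t - x).
  by rewrite -poissonN opprB; exact: trunc_inv_sub_cpoisson.
have ikap : L1 kap by exact: L1_le mkap (L1_poisson x e0) kp.
have kap0 : \int[mu]_t kap t = 0.
  apply: (@int_odd _ (2 * x)) => // t; rewrite /kap.
  have -> : x - (2 * x - t) = - (x - t) by ring.
  by rewrite trunc_invN cpoissonN opprD.
have pe t : `|poisson e (t - x)| <= e^-1 by exact: cauchy_part_bounded (poisson_part _).
have ifk : L1 (fun t => f t * kap t).
  apply: (@L1_mul_bounded _ _ _ e^-1) => // t; apply: (le_trans (kp t)).
  by apply: le_trans (pe t); exact: ler_norm.
have iq := L1_conv x e0 (cpoisson_part _) fi.
have pvE : truncated_pv f x e = \int[mu]_t (f t * kap t + f t * cpoisson e (x - t)).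
  rewrite /truncated_pv Rintegral_mkcond; apply: eq_Rintegral => t _.
  rewrite /kap mulrBr subrK patchE /trunc_inv.
  case: ifPn => [|/negP] h; rewrite inE/= in h; first by rewrite h.
  by move/negP/negbTE: h => ->; rewrite mulr0.
rewrite pvE (intD ifk iq) addrK.
have -> : \int[mu]_t (f t * kap t) = \int[mu]_t (f t * kap t - f x * kap t).
  by rewrite (intB ifk (L1Z (f x) ikap)) (intZ (f x) ikap) kap0 mulr0 subr0.
apply: le_trans le; apply: norm_int_le => //.
  apply: measurable_funB; first exact: L1_measurable ifk.
  exact: L1_measurable (L1Z (f x) ikap).
by move=> t; rewrite -mulrBl normrM mulrC ler_wpM2r.
Unshelve. all: by end_near. Qed.

Lemma cvg_poisson_lebesgue_pt (H : R -> R) (x : R) : measurable_fun setT H ->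
  (forall e, 0 < e -> L1 (fun t => poisson e (x - t) * H t)) -> lebesgue_pt H x ->
  \int[mu]_t (poisson e (x - t) * H t) @[e --> 0^'+] --> pi * H x.
Proof.
move=> mH ip Hx.
have pE e t : poisson e (x - t) = poisson e (t - x) by rewrite -poissonN opprB.
have ip1 : L1 (fun t => poisson 1 (t - x) * `|H t - H x|).
  have i1 := L1_norm (ip 1 ltr01); have i2 := L1Z `|H x| (L1_poisson x (ltr01 : 0 < (1:R))).
  apply: (L1_le _ (L1D i1 i2)).
  - apply: measurable_funM; first by apply: measurable_subr; exact: measurable_poisson.
    by apply: measurableT_comp => //; exact: measurable_funB.
  - move=> t; rewrite pE.
    move: (poisson 1 (t - x)) (poisson_ge0 (t - x) (ltr01 : 0 < (1:R))) => p p0.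
    rewrite !normrM normr_id (ger0_norm p0) (mulrC `|H x|) -mulrDr ler_wpM2l//.
    exact: ler_normB.
apply/cvgrPdist_le => /= eta eta0.
have := poisson_oscillation_small mH ip1 Hx eta0; apply: filter_app; near=> e.
move=> [ie le].
have e0 : 0 < e by near: e; exact: nbhs_right_gt.
have i1 := L1Z (H x) (L1_poisson x e0).
have -> : pi * H x = \int[mu]_t (H x * poisson e (t - x)).
  by rewrite (intZ (H x) (L1_poisson x e0)) (int_poisson x e0) mulrC.
rewrite -(intB i1 (ip e e0)).
apply: le_trans le; apply: norm_int_le => //.
  apply: measurable_funB; first exact: L1_measurable i1.
  exact: L1_measurable (ip e e0).
by move=> t; rewrite pE mulrC -mulrBr normrM (ger0_norm (poisson_ge0 _ e0)) distrC.
Unshelve. all: by end_near. Qed.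

End LebesguePoint.


(** * The Hilbert transform and its moments *)

Section Hilbert.
Context {R : realType}.
Local Notation mu := (@lebesgue_measure R).
Implicit Types (f g h : R -> R).

(** On a bounded set the Poisson kernel is bounded away from 0. *)
Lemma locally_integrable_poisson (H : R -> R) : measurable_fun setT H ->
  L1 (fun t => poisson 1 (0 - t) * H t) -> locally_integrable setT H.
Proof.
move=> mH ip; split=> //; first exact: openT.
move=> K _ cK.
have [M [_ MP]] := compact_bounded cK.
pose m : R := `|M| + 1.
have Km t : K t -> `|t| <= m.
  by move=> Kt; apply: (MP m _ t Kt); rewrite /m ltr_pwDr// ler_norm.
have i := L1_norm (L1Z (1 + m ^+ 2) ip).
apply: (@le_lt_trans _ _ (\int[mu]_(t in K) (`|(1 + m ^+ 2) * (poisson 1 (0 - t) * H t)|)%:E)%E).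
  apply: ge0_le_integral => //=.
  - exact: compact_measurable.
  - apply: (measurable_EFinP _ _).2; apply: measurableT_comp => //.
    exact: measurable_funTS.
  - apply: (measurable_EFinP _ _).2; apply: measurable_funTS; exact: L1_measurable i.
  - move=> t Kt; rewrite lee_fin mulrA normrM ler_peMl//.
    have q := quad_gt0 (0 - t) (ltr01 : 0 < (1:R)).
    rewrite ger0_norm; last by rewrite mulr_ge0 ?poisson_ge0// addr_ge0// sqr_ge0.
    rewrite /poisson mulrA mulr1 ler_pdivlMr// mul1r expr1n addrC lerD2l sub0r sqrrN.
    rewrite -(real_normK (num_real t)) ler_sqr ?nnegrE ?Km//.
    exact: le_trans (Km t Kt).
have iK : mu.-integrable K (EFin \o (fun t => `|(1 + m ^+ 2) * (poisson 1 (0 - t) * H t)|)).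
  apply: integrableS i => //; exact: compact_measurable.
by apply: integrable_lty; last exact: iK; exact: compact_measurable.
Qed.

(** At a common Lebesgue point of [f] and of the boundary value [H], the truncated
    integral follows [conv (cpoisson e) f], which is the Poisson integral of [H]
    divided by [pi]. *)
Lemma principal_value f : L1 f -> L1 (fun x => f x ^+ 2) ->
  exists H : R -> R, [/\ measurable_fun setT H,
    {ae mu, forall x, truncated_pv f x e @[e --> 0^'+] --> H x},
    (forall s x, 0 < s -> L1 (fun t => poisson s (x - t) * H t)) &
    forall s x, 0 < s -> \int[mu]_t (poisson s (x - t) * H t) = pi * conv (cpoisson s) f x].
Proof.
move=> fi f2; have [H mH HP] := conj_boundary_value fi f2.
exists H; split=> //; [|by move=> s x /(HP s x)[]|by move=> s x /(HP s x)[]].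
have lf : locally_integrable setT f by apply: open_integrable_locally => //; exact: openT.
have lH : locally_integrable setT H.
  by apply: locally_integrable_poisson => //; exact: (HP _ _ ltr01).1.
apply: ae_mono (ae_and (lebesgue_differentiation lf) (lebesgue_differentiation lH)) => x [fx Hx].
have c1 := truncated_pv_lebesgue_pt fi fx.
have c2 := cvg_poisson_lebesgue_pt mH (fun e e0 => (HP e x e0).1) Hx.
have c3 : conv (cpoisson e) f x @[e --> 0^'+] --> H x.
  have c4 : pi^-1 * \int[mu]_t (poisson e (x - t) * H t) @[e --> 0^'+] --> pi^-1 * (pi * H x).
    exact: cvgMr.
  rewrite mulKf in c4; last by rewrite gt_eqF// pi_gt0.
  apply: cvg_trans c4; apply: near_eq_cvg; near=> e.
  have e0 : 0 < e by near: e; exact: nbhs_right_gt.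
  by rewrite (HP e x e0).2 mulKf// gt_eqF// pi_gt0.
have c5 : (truncated_pv f x e - conv (cpoisson e) f x) + conv (cpoisson e) f x
    @[e --> 0^'+] --> 0 + H x.
  exact: cvgD.
rewrite add0r in c5; move: c5; apply: cvg_trans; apply: near_eq_cvg.
by apply: nearW => e; rewrite subrK.
Unshelve. all: by end_near. Qed.

(** The Hilbert transform of a real function, on which the complex one acts
    componentwise ([hilbert_transformE]). *)
Definition real_hilbert f (x : R) : R := lim (pi^-1 * truncated_pv f x e @[e --> 0^'+]).

(** The first Cauchy identity, by passing from [H / pi] to the almost everywhere
    equal Hilbert transform.  Measurability has to be assumed, because the limit
    takes unspecified values where the principal value does not exist. *)
Lemma poisson_real_hilbert f : L1 f -> L1 (fun x => f x ^+ 2) ->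
  measurable_fun setT (real_hilbert f) ->
  forall s x, 0 < s ->
   \int[mu]_t (poisson s (x - t) * real_hilbert f t) = conv (cpoisson s) f x.
Proof.
move=> fi f2 mh s x s0; have [H [mH aeH iH eH]] := principal_value fi f2.
have mp : measurable_fun setT (fun t : R => poisson s (x - t)).
  by apply: measurable_rsub; exact: measurable_poisson.
have -> : \int[mu]_t (poisson s (x - t) * real_hilbert f t) =
    \int[mu]_t (pi^-1 * (poisson s (x - t) * H t)).
  apply: ae_int.
  - exact: measurable_funM.
  - by apply: measurable_funM => //; exact: measurable_funM.
  - apply: ae_mono aeH => t Ht.
    have -> : real_hilbert f t = pi^-1 * H t by apply: cvg_lim => //; apply: cvgMr.
    by rewrite mulrCA.
rewrite (intZ _ (iH s x s0)) eH// mulKf// gt_eqF// pi_gt0//.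
Qed.

(** The second Cauchy identity follows from the first by convolving it with
    [cpoisson y]: on one side [cpoisson] with [poisson] gives [cpoisson], on
    the other [cpoisson] with [cpoisson] gives [- poisson].  The height [r] is
    split as [2 r / 3 + r / 3], in unequal parts as [int_poisson_cpoisson]
    requires. *)
Lemma cpoisson_real_hilbert f : L1 f -> L1 (fun x => f x ^+ 2) -> L1 (real_hilbert f) ->
  forall r, 0 < r ->
   \int[mu]_t (real_hilbert f t * cpoisson r t) = \int[mu]_t (f t * poisson r t).
Proof.
move=> fi f2 hi r r0.
have mh := L1_measurable hi.
pose y := r / 3; pose s := 2 * r / 3.
have y0 : 0 < y by rewrite /y; lra.
have s0 : 0 < s by rewrite /s; lra.
have sy : s != y by rewrite gt_eqF// /y /s; lra.
have sE : s + y = r by rewrite /s /y; lra.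
have [mq q2] := cpoisson_shift_sqr 0 y0.
have [_ e] := conv_fubini s0 (poisson_part _) hi mq q2.
have cE : conv (poisson s) (real_hilbert f) = conv (cpoisson s) f.
  apply/funext => x; rewrite -(poisson_real_hilbert fi f2 mh x s0).
  by apply: eq_Rintegral => t _; rewrite mulrC.
rewrite cE int_cpoisson_conv// sE in e.
have pi0 : (pi : R) != 0 by rewrite gt_eqF// pi_gt0.
have qhi : L1 (fun t => real_hilbert f t * cpoisson r t).
  apply: (@L1_mul_bounded _ _ _ r^-1) => //; first exact: measurable_cpoisson.
  by move=> t; exact: cauchy_part_bounded (cpoisson_part _).
apply: (mulfI pi0); rewrite -(intZ pi qhi).
transitivity (\int[mu]_b (real_hilbert f b * \int[mu]_x (cpoisson y (x - 0) * poisson s (x - b)))).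
  apply: eq_Rintegral => b _; rewrite mulrCA; congr (_ * _).
  rewrite -[b in LHS]subr0 -sE -int_poisson_cpoisson//.
  by apply: eq_Rintegral => x _; rewrite mulrC -poissonN opprB.
rewrite -e; congr (_ * _); apply: eq_Rintegral => b _.
by rewrite sub0r poissonN.
Qed.

Lemma mul_poisson (s t : R) : 0 < s -> s * poisson s t = 1 - t * cpoisson s t.
Proof.
move=> s0; have q := quad_gt0 t s0.
by rewrite /poisson /cpoisson; field; rewrite gt_eqF.
Qed.

Lemma mul_poisson_cpoisson (s t : R) : t * poisson s t = s * cpoisson s t.
Proof. by rewrite /poisson /cpoisson mulrCA. Qed.

(** The expansion of the two Cauchy integrals at infinity, order by order. *)
Lemma moments_of_cauchy f h (N : nat) :
  (forall n, (n < N)%N -> L1 (fun t => t ^+ n * f t)) ->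
  (forall n, (n < N)%N -> \int[mu]_t (t ^+ n * f t) = 0) ->
  (forall n, (n < N)%N -> L1 (fun t => t ^+ n * h t)) ->
  (forall s, 0 < s -> \int[mu]_t (h t * poisson s t) = - \int[mu]_t (f t * cpoisson s t)) ->
  (forall s, 0 < s -> \int[mu]_t (h t * cpoisson s t) = \int[mu]_t (f t * poisson s t)) ->
  forall n, (n < N)%N -> \int[mu]_t (t ^+ n * h t) = 0.
Proof.
move=> fi f0 hi A0 B0.
have ik g (s : R) k : 0 < s -> cauchy_part s k -> L1 g -> L1 (fun t => g t * k t).
  move=> s0 kk gi; apply: (@L1_mul_bounded _ _ _ s^-1) => //.
    exact: measurable_cauchy_part kk.
  by move=> t; exact: cauchy_part_bounded kk.
(* multiply by [s = m + 1] and let [m] tend to infinity *)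
have lim_moment n : (n < N)%N ->
    (forall s, 0 < s ->
      \int[mu]_t (t ^+ n * h t * poisson s t) = - \int[mu]_t (t ^+ n * f t * cpoisson s t)) ->
    \int[mu]_t (t ^+ n * h t) = 0.
  move=> nN AE.
  have s0 m : (0 : R) < m.+1%:R by rewrite ltr0n.
  have kc (k : R -> R -> R) t : (forall s, cauchy_part s (k s)) -> k m.+1%:R t @[m --> \oo] --> 0.
    move=> kk; have hm : m.+1%:R^-1 @[m --> \oo] --> (0:R) by exact: cvg_harmonic.
    apply: (@squeeze_cvgr _ _ _ _ (fun m => - (m.+1%:R^-1)) (fun m => m.+1%:R^-1)) => //.
      by apply: nearW => m; rewrite -ler_norml; exact: cauchy_part_bounded (kk _).
    by rewrite -oppr0; exact: cvgN.
  have pc t : m.+1%:R * poisson m.+1%:R t @[m --> \oo] --> (1:R).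
    have : 1 - t * cpoisson m.+1%:R t @[m --> \oo] --> 1 - t * 0.
      by apply: cvgB; [exact: cvg_cst|apply: cvgMr; exact: kc (@cpoisson_part R)].
    rewrite mulr0 subr0; apply: cvg_trans; apply: near_eq_cvg; apply: nearW => m.
    by rewrite mul_poisson.
  have qc t : m.+1%:R * cpoisson m.+1%:R t @[m --> \oo] --> (0:R).
    have : t * poisson m.+1%:R t @[m --> \oo] --> t * 0.
      by apply: cvgMr; exact: kc (@poisson_part R).
    rewrite mulr0; apply: cvg_trans; apply: near_eq_cvg; apply: nearW => m.
    by rewrite mul_poisson_cpoisson.
  have bnd (s : R) k g t : 0 < s -> cauchy_part s k -> `|s * (g t * k t)| <= `|g t|.
    move=> s1 kk; rewrite mulrCA normrM ler_piMr// normrM gtr0_norm//.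
    by rewrite -ler_pdivlMl// mulr1; exact: cauchy_part_bounded kk.
  have cvg_int (k : R -> R -> R) g (c : R) : (forall s, cauchy_part s (k s)) -> L1 g ->
      (forall t, m.+1%:R * k m.+1%:R t @[m --> \oo] --> c) ->
      m.+1%:R * \int[mu]_t (g t * k m.+1%:R t) @[m --> \oo] --> c * \int[mu]_t g t.
    move=> kk gi kcv.
    have ig m := ik g m.+1%:R (k m.+1%:R) (s0 m) (kk _) gi.
    rewrite -(intZ c gi).
    have : \int[mu]_t (m.+1%:R * (g t * k m.+1%:R t)) @[m --> \oo] --> \int[mu]_t (c * g t).
      apply: (@dominated_cvg_int _ (fun m t => m.+1%:R * (g t * k m.+1%:R t)) _ (fun t => `|g t|)).
      - by move=> m; exact: L1_measurable (L1Z m.+1%:R (ig m)).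
      - exact: L1_measurable (L1Z c gi).
      - move=> t; under eq_fun do rewrite mulrCA; rewrite mulrC.
        by apply: cvgMr; exact: kcv.
      - exact: L1_norm.
      - by move=> m t; exact: bnd.
    apply: cvg_trans; apply: near_eq_cvg; apply: nearW => m.
    by rewrite (intZ m.+1%:R (ig m)).
  have c1 := cvg_int _ _ _ (@poisson_part R) (hi n nN) pc.
  have c2 := cvg_int _ _ _ (@cpoisson_part R) (fi n nN) qc.
  rewrite mul1r in c1; rewrite mul0r in c2.
  have c3 : - (m.+1%:R * \int[mu]_t (t ^+ n * f t * cpoisson m.+1%:R t)) @[m --> \oo] --> (0:R).
    by rewrite -oppr0; exact: cvgN.
  suff c4 : m.+1%:R * \int[mu]_t (t ^+ n * h t * poisson m.+1%:R t) @[m --> \oo] --> (0:R).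
    exact: (cvg_unique _ c1 c4).
  apply: cvg_trans c3; apply: near_eq_cvg; apply: nearW => m.
  by rewrite AE// mulrN.
suff AB n : (n < N)%N -> (forall s, 0 < s ->
    \int[mu]_t (t ^+ n * h t * poisson s t) = - \int[mu]_t (t ^+ n * f t * cpoisson s t)) /\
  (forall s, 0 < s ->
    \int[mu]_t (t ^+ n * h t * cpoisson s t) = \int[mu]_t (t ^+ n * f t * poisson s t)).
  by move=> n nN; apply: lim_moment => //; exact: (AB n nN).1.
elim: n => [|n IH] nN.
  have E g k : \int[mu]_t (t ^+ 0 * g t * k t) = \int[mu]_t (g t * k t).
    by apply: eq_Rintegral => t _; rewrite mul1r.
  by split=> s s0; rewrite !E; [exact: A0|exact: B0].
have nN' : (n < N)%N by exact: ltnW.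
have {IH}[An Bn] := IH nN'.
have h0 := lim_moment n nN' An.
(* [t p_s = s q_s] *)
have shift g s : 0 < s -> L1 (fun t => t ^+ n * g t) ->
    \int[mu]_t (t ^+ n.+1 * g t * poisson s t) = s * \int[mu]_t (t ^+ n * g t * cpoisson s t).
  move=> s0 gi; rewrite -(intZ s (ik _ s (cpoisson s) s0 (cpoisson_part s) gi)).
  apply: eq_Rintegral => t _.
  transitivity (t ^+ n * g t * (t * poisson s t)); first by rewrite exprS; ring.
  by rewrite mul_poisson_cpoisson; ring.
(* [t q_s = 1 - s p_s] *)
have split' g s : 0 < s -> L1 (fun t => t ^+ n * g t) ->
    \int[mu]_t (t ^+ n.+1 * g t * cpoisson s t) =
    \int[mu]_t (t ^+ n * g t) - s * \int[mu]_t (t ^+ n * g t * poisson s t).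
  move=> s0 gi; have gpi := ik _ s (poisson s) s0 (poisson_part s) gi.
  rewrite -(intZ s gpi) -(intB gi (L1Z s gpi)).
  apply: eq_Rintegral => t _.
  transitivity (t ^+ n * g t * (t * cpoisson s t)); first by rewrite exprS; ring.
  have -> : t * cpoisson s t = 1 - s * poisson s t by rewrite mul_poisson// subKr.
  by ring.
have hn := hi n nN'; have fn := fi n nN'.
split=> s s0; rewrite shift// split'//.
  by rewrite Bn// f0// sub0r opprK.
by rewrite h0 An// sub0r mulrN opprK.
Qed.

Lemma hilbert_vanishing_moments f (N : nat) : L1 (fun x => f x ^+ 2) ->
  (forall n, (n < N)%N -> L1 (fun t => t ^+ n * f t)) ->
  (forall n, (n < N)%N -> \int[mu]_t (t ^+ n * f t) = 0) ->
  (forall n, (n < N)%N -> L1 (fun t => t ^+ n * real_hilbert f t)) ->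
  forall n, (n < N)%N -> \int[mu]_t (t ^+ n * real_hilbert f t) = 0.
Proof.
move=> f2 fi f0 hi n nN.
have N0 : (0 < N)%N by exact: leq_ltn_trans nN.
have f1 : L1 f.
  by have := fi 0%N N0; apply: eq_integrable => // t _ /=; rewrite mul1r.
have h1 : L1 (real_hilbert f).
  by have := hi 0%N N0; apply: eq_integrable => // t _ /=; rewrite mul1r.
apply: (moments_of_cauchy fi f0 hi) => // s s0; last exact: cpoisson_real_hilbert.
have := poisson_real_hilbert f1 f2 (L1_measurable h1) 0 s0.
have -> : \int[mu]_t (poisson s (0 - t) * real_hilbert f t) =
    \int[mu]_t (real_hilbert f t * poisson s t).
  by apply: eq_Rintegral => t _; rewrite sub0r poissonN mulrC.
move=> ->; rewrite -mulN1r -intZ; last first.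
  apply: (@L1_mul_bounded _ _ _ s^-1) => //; first exact: measurable_cpoisson.
  by move=> t; exact: cauchy_part_bounded (cpoisson_part _).
by apply: eq_Rintegral => t _; rewrite sub0r cpoissonN mulrN mulN1r.
Qed.

Lemma hartley_vanishing_moments f (N : nat) (c eps : R) : c != 0 -> eps != 0 ->
  L1 (fun x => f x ^+ 2) ->
  (forall n, (n < N)%N -> L1 (fun t => t ^+ n * f t)) ->
  (forall n, (n < N)%N -> \int[mu]_t (t ^+ n * f t) = 0) ->
  (forall n, (n < N)%N -> L1 (fun t => t ^+ n * (c * (f t + eps * real_hilbert f t)))) ->
  forall n, (n < N)%N -> \int[mu]_t (t ^+ n * (c * (f t + eps * real_hilbert f t))) = 0.
Proof.
move=> c0 e0 f2 fi f0 gi.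
have hi n : (n < N)%N -> L1 (fun t => t ^+ n * real_hilbert f t).
  move=> nN.
  have := L1Z eps^-1 (L1B (L1Z c^-1 (gi n nN)) (fi n nN)).
  apply: eq_integrable => // t _ /=; congr EFin.
  by move: (real_hilbert f t) (f t) => u v; field; rewrite c0 e0.
move=> n nN.
have i2 := L1Z eps (hi n nN).
have -> : \int[mu]_t (t ^+ n * (c * (f t + eps * real_hilbert f t))) =
    \int[mu]_t (c * (t ^+ n * f t + eps * (t ^+ n * real_hilbert f t))).
  by apply: eq_Rintegral => t _; move: (real_hilbert f t) (f t) => u v; ring.
rewrite (intZ c (L1D (fi n nN) i2)) (intD (fi n nN) i2) (intZ eps (hi n nN)).
by rewrite f0// (hilbert_vanishing_moments f2 fi f0 hi nN) mulr0 addr0 mulr0.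
Qed.

End Hilbert.

Section Complex.
Context {R : realType}.
Local Notation mu := (@lebesgue_measure R).
Local Open Scope complex_scope.
Implicit Types (g psi : R -> R[i]).

Definition re_part g (t : R) := complex.Re (g t).
Definition im_part g (t : R) := complex.Im (g t).

Lemma Re_realM (r : R) (z : R[i]) : complex.Re (r%:C * z) = r * complex.Re z.
Proof. by case: z => a b /=; rewrite mul0r subr0. Qed.
Lemma Im_realM (r : R) (z : R[i]) : complex.Im (r%:C * z) = r * complex.Im z.
Proof. by case: z => a b /=; rewrite mul0r addr0. Qed.

Lemma hilbert_transformE g (t : R) :
  hilbert_transform g t = real_hilbert (re_part g) t +i* real_hilbert (im_part g) t.
Proof.
have E (z : R[i]) (r : R) : z / r%:C = (r^-1)%:C * z by rewrite fmorphV mulrC.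
have ReE e : complex.Re (truncated_hilbert g t e) = pi^-1 * truncated_pv (re_part g) t e.
  rewrite /truncated_hilbert Re_realM /=; congr (_ * _).
  by apply: eq_Rintegral => u _; rewrite E Re_realM mulrC.
have ImE e : complex.Im (truncated_hilbert g t e) = pi^-1 * truncated_pv (im_part g) t e.
  rewrite /truncated_hilbert Im_realM /=; congr (_ * _).
  by apply: eq_Rintegral => u _; rewrite E Im_realM mulrC.
by rewrite /hilbert_transform /real_hilbert (funext ReE) (funext ImE).
Qed.

Definition sign (plus : bool) : R := if plus then 1 else -1.

Lemma sign_neq0 (plus : bool) : sign plus != 0.
Proof. by rewrite /sign; case: plus; rewrite ?oppr_eq0 oner_eq0. Qed.

Lemma re_hartley (plus : bool) psi t : complex.Re (hartley_like plus psi t) =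
  (Num.sqrt 2)^-1 * (re_part psi t + sign plus * real_hilbert (re_part psi) t).
Proof.
rewrite /hartley_like Re_realM hilbert_transformE /re_part /sign.
by case: plus; case: (psi t) => a b /=; rewrite ?mul1r ?mulN1r.
Qed.

Lemma im_hartley (plus : bool) psi t : complex.Im (hartley_like plus psi t) =
  (Num.sqrt 2)^-1 * (im_part psi t + sign plus * real_hilbert (im_part psi) t).
Proof.
rewrite /hartley_like Im_realM hilbert_transformE /im_part /sign.
by case: plus; case: (psi t) => a b /=; rewrite ?mul1r ?mulN1r.
Qed.

End Complex.

Theorem proposition6 (R : realType) (N : nat) (psi : R -> R[i]%C) (plus : bool)
  (psi_wavelet : wavelet psi)
  (psi_moments : vanishing_moments N psi)
  (psiH_has_moments :
     forall n : nat, (n < N)%N -> has_moment n (hartley_like plus psi)) :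
  vanishing_moments N (hartley_like plus psi).
Proof.
have [[re2 im2] _] := psi_wavelet.
have c0 : (Num.sqrt 2)^-1 != 0 :> R by rewrite invr_eq0 sqrtr_eq0 -ltNge ltr0n.
have s0 : sign plus != 0 :> R by exact: sign_neq0.
have ReX n g t : complex.Re ((t ^+ n)%:C%C * g t) = t ^+ n * re_part g t :> R by exact: Re_realM.
have ImX n g t : complex.Im ((t ^+ n)%:C%C * g t) = t ^+ n * im_part g t :> R by exact: Im_realM.
move=> n nN; split; first exact: psiH_has_moments.
have L1re m : (m < N)%N -> L1 (fun t => t ^+ m * re_part psi t).
  move=> mN; have [[i _] _] := psi_moments m mN.
  by move: i; apply: eq_integrable => // t _ /=; rewrite ReX.
have L1im m : (m < N)%N -> L1 (fun t => t ^+ m * im_part psi t).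
  move=> mN; have [[_ i] _] := psi_moments m mN.
  by move: i; apply: eq_integrable => // t _ /=; rewrite ImX.
have re0 m : (m < N)%N -> \int[lebesgue_measure]_t (t ^+ m * re_part psi t) = 0.
  move=> mN; have [_ [e _]] := psi_moments m mN.
  by rewrite -[RHS]e; apply: eq_Rintegral => t _; rewrite ReX.
have im0 m : (m < N)%N -> \int[lebesgue_measure]_t (t ^+ m * im_part psi t) = 0.
  move=> mN; have [_ [_ e]] := psi_moments m mN.
  by rewrite -[RHS]e; apply: eq_Rintegral => t _; rewrite ImX.
have L1reH m : (m < N)%N -> L1 (fun t => t ^+ m * ((Num.sqrt 2)^-1 *
    (re_part psi t + sign plus * real_hilbert (re_part psi) t))).
  move=> mN; have [i _] := psiH_has_moments m mN.
  by move: i; apply: eq_integrable => // t _ /=; rewrite ReX /re_part re_hartley.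
have L1imH m : (m < N)%N -> L1 (fun t => t ^+ m * ((Num.sqrt 2)^-1 *
    (im_part psi t + sign plus * real_hilbert (im_part psi) t))).
  move=> mN; have [_ i] := psiH_has_moments m mN.
  by move: i; apply: eq_integrable => // t _ /=; rewrite ImX /im_part im_hartley.
have reH := hartley_vanishing_moments c0 s0 (Lfun2_integrable_sqr re2) L1re re0 L1reH nN.
have imH := hartley_vanishing_moments c0 s0 (Lfun2_integrable_sqr im2) L1im im0 L1imH nN.
rewrite /moment /cintegral; apply/eqP; rewrite eq_complex /=.
apply/andP; split; apply/eqP.
  by rewrite -[RHS]reH; apply: eq_Rintegral => t _; rewrite ReX /re_part re_hartley.
by rewrite -[RHS]imH; apply: eq_Rintegral => t _; rewrite ImX /im_part im_hartley.
Qed.
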